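(* For every bounded $\mathbb{S}^{[2]}$-module $\mathcal{V}$, the functor $$P_{\mathcal{V}}:\mathbb{S}\text{-}\mathsf{Vect}\to\mathsf{Vect},\qquad \mathcal{W}\mapsto\bigoplus_{\nu\in\mathrm{Part}}\mathcal{V}(\nu)\otimes_{\mathbb{S}_\nu}\mathcal{W}^{\otimes\nu}$$ is polynomial. The assignment $\mathcal{V}\mapsto P_{\mathcal{V}}$ defines an equivalence between the category $\mathbb{S}^{[2]}\text{-}\mathsf{Vect}^\star$ of bounded $\mathbb{S}^{[2]}$-modules and the category $\mathbf{P}[\mathbb{S}\text{-}\mathsf{Vect},\mathsf{Vect}]$ of polynomial functors $\mathbb{S}\text{-}\mathsf{Vect}\to\mathsf{Vect}$.
   Context: $\mathrm{Part}$ is the set of generalized integer partitions: finitely supported functions $\nu:\mathbb{Z}_{\ge0}\to\mathbb{Z}_{\ge0}$, $i\mapsto\nu_i$. For $\nu\in\mathrm{Part}$, $\mathbb{S}_\nu:=\prod_{i\ge0}S_i\wr S_{\nu_i}$, where $S_i\wr S_n=(S_i)^n\rtimes S_n$ and $S_0\wr S_n=S_n$. $\mathsf{Vect}$ is the category of finite-dimensional $\mathbb{Q}$-vector spaces. An $\mathbb{S}$-module $\mathcal{W}$ is a collection $\{\mathcal{W}(n)\mid n\ge0\}$ with each $\mathcal{W}(n)$ a finite-dimensional $S_n$-representation over $\mathbb{Q}$; $\mathbb{S}\text{-}\mathsf{Vect}$ is the category of $\mathbb{S}$-modules. An $\mathbb{S}^{[2]}$-module $\mathcal{V}$ is a collection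 $\{\mathcal{V}(\lambda)\mid\lambda\in\mathrm{Part}\}$ with each $\mathcal{V}(\lambda)$ a finite-dimensional rational $\mathbb{S}_\lambda$-representation; it is bounded if $\bigoplus_\lambda\mathcal{V}(\lambda)$ is finite-dimensional. Morphisms are collections of equivariant linear maps. For an $\mathbb{S}$-module $\mathcal{W}$ and $\nu\in\mathrm{Part}$, $\mathcal{W}^{\otimes\nu}:=\bigotimes_{i\ge0}\mathcal{W}(i)^{\otimes\nu_i}$ with its natural $\mathbb{S}_\nu$-action ($S_i\wr S_{\nu_i}$ acts on $\mathcal{W}(i)^{\otimes\nu_i}$). A map $\varphi:V\to W$ of $\mathbb{Q}$-vector spaces is polynomial if for all $v_1,\dots,v_n\in V$ the map $(\alpha_1,\dots,\alpha_n)\mapsto\varphi(\sum\alpha_iv_i)$ is a polynomial in the $\alpha_i$ with coefficients in $W$. A functor $F:\mathsf{C}_1\to\mathsf{C}_2$ between $\mathbb{Q}$-linear abelian categories is a polynomial functor if all maps $\mathrm{Hom}(U,V)\to\mathrm{Hom}(FU,FV)$ are polynomial. For each object $X$ and scalar $\alpha$, $F(\alpha\,\mathrm{id}_X)=\sum_i\varphi_i(X)\alpha^i$, and $F=\bigoplus_iF_i$ with $F_iX=\mathrm{im}\,\varphi_i(X)$; $F$ is bounded if $F_i=0$ for $i\gg0$. $\mathbf{P}[\mathsf{C}_1,\mathsf{C}_2]$ is the category of bounded polynomial functors $\mathsf{C}_1\to\mathsf{C}_2$ and natural transformations. *)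

(* Defs.v *)
From HB Require Import structures.
From mathcomp Require Import all_boot all_order all_algebra all_fingroup.
From mathcomp Require Import finmap.
From mathcomp Require Import boolp.

Set Implicit Arguments.
Unset Strict Implicit.
Unset Printing Implicit Defensive.

Import GRing.Theory.
Local Open Scope ring_scope.

Record category := Category {
  ob :> Type;
  hom : ob -> ob -> Type;
  idm : forall X, hom X X;
  comp : forall X Y Z, hom Y Z -> hom X Y -> hom X Z;
  comp1m : forall X Y (f : hom X Y), comp (idm Y) f = f;
  compm1 : forall X Y (f : hom X Y), comp f (idm X) = f;
  compA : forall X Y Z T (h : hom Z T) (g : hom Y Z) (f : hom X Y),
    comp h (comp g f) = comp (comp h g) f }.
Arguments idm {c} X.
Arguments comp {c X Y Z}.

Record functor (C D : category) := Functor {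
  fobj :> C -> D;
  fmap : forall X Y, hom X Y -> hom (fobj X) (fobj Y);
  fmap_id : forall X, fmap (idm X) = idm (fobj X);
  fmap_comp : forall X Y Z (g : hom Y Z) (f : hom X Y),
    fmap (comp g f) = comp (fmap g) (fmap f) }.
Arguments fmap {C D} f0 {X Y}.

Section FunctorOperations.
Variables C D E : category.

Program Definition id_functor : functor C C :=
  @Functor C C (fun X => X) (fun X Y f => f) _ _.

Program Definition comp_functor (G : functor D E) (F : functor C D) :
    functor C E :=
  @Functor C E (fun X => G (F X)) (fun X Y f => fmap G (fmap F f)) _ _.
Next Obligation. by rewrite !fmap_id. Qed.
Next Obligation. by rewrite !fmap_comp. Qed.

End FunctorOperations.

Section NaturalTransformations.
Variables C D : category.

Record natural (F G : functor C D) := Natural {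
  ncomp :> forall X : C, hom (F X) (G X);
  naturality : forall X Y (f : hom X Y),
    comp (ncomp Y) (fmap F f) = comp (fmap G f) (ncomp X) }.

Lemma natural_eq F G (s t : natural F G) : (forall X, s X = t X) -> s = t.
Proof.
case: s t => [s sP] [t tP] /= st.
have {}st : s = t by apply: functional_extensionality_dep.
by subst t; congr Natural; apply: Prop_irrelevance.
Qed.

Program Definition nat_id (F : functor C D) : natural F F :=
  @Natural F F (fun X => idm (F X)) _.
Next Obligation. by rewrite comp1m compm1. Qed.

Program Definition nat_comp F G H (t : natural G H) (s : natural F G) :
    natural F H :=
  @Natural F H (fun X => comp (t X) (s X)) _.
Next Obligation. by rewrite -compA naturality compA naturality compA. Qed.

Program Definition functor_cat : category :=
  @Category (functor C D) natural nat_id nat_comp _ _ _.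
Next Obligation. by apply: natural_eq => Z0 /=; rewrite comp1m. Qed.
Next Obligation. by apply: natural_eq => Z0 /=; rewrite compm1. Qed.
Next Obligation. by apply: natural_eq => Z0 /=; rewrite compA. Qed.

Definition naturally_isomorphic (F G : functor C D) : Prop :=
  exists (s : natural F G) (t : natural G F),
    forall X, comp (t X) (s X) = idm (F X) /\ comp (s X) (t X) = idm (G X).

End NaturalTransformations.

Definition is_equivalence (C D : category) (F : functor C D) : Prop :=
  exists G : functor D C,
    naturally_isomorphic (comp_functor G F) (id_functor C) /\
    naturally_isomorphic (comp_functor F G) (id_functor D).

Section FullSubcategories.

Record fullsub_ob (C : category) (P : C -> Prop) :=
  FullSubOb { fs_ob :> C; fs_prop : P fs_ob }.

Definition fullsub (C : category) (P : C -> Prop) : category :=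
  @Category (fullsub_ob P) (fun X Y => hom (fs_ob X) (fs_ob Y))
    (fun X => idm (fs_ob X)) (fun X Y Z => @comp C _ _ _)
    (fun X Y => @comp1m C _ _) (fun X Y => @compm1 C _ _)
    (fun X Y Z T => @compA C _ _ _ _).

Definition corestrict (C D : category) (P : D -> Prop) (F : functor C D)
    (FP : forall X, P (F X)) : functor C (fullsub P) :=
  @Functor C (fullsub P) (fun X => FullSubOb (FP X)) (fun X Y => @fmap C D F X Y)
    (@fmap_id C D F) (@fmap_comp C D F).

End FullSubcategories.

Record qcategory := QCategory {
  qob : Type;
  qhom : qob -> qob -> lmodType rat;
  qid : forall X, qhom X X;
  qcomp : forall X Y Z, qhom Y Z -> qhom X Y -> qhom X Z;
  qcomp1m : forall X Y (f : qhom X Y), qcomp (qid Y) f = f;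
  qcompm1 : forall X Y (f : qhom X Y), qcomp f (qid X) = f;
  qcompA : forall X Y Z T (h : qhom Z T) (g : qhom Y Z) (f : qhom X Y),
    qcomp h (qcomp g f) = qcomp (qcomp h g) f;
  qcompPl : forall X Y Z a (g g' : qhom Y Z) (f : qhom X Y),
    qcomp (a *: g + g') f = a *: qcomp g f + qcomp g' f;
  qcompPr : forall X Y Z a (g : qhom Y Z) (f f' : qhom X Y),
    qcomp g (a *: f + f') = a *: qcomp g f + qcomp g f' }.

Coercion qcat (C : qcategory) : category :=
  @Category (qob C) (fun X Y => qhom X Y) (@qid C) (@qcomp C)
    (@qcomp1m C) (@qcompm1 C) (@qcompA C).

Definition polynomial_map (V W : lmodType rat) (phi : V -> W) : Prop :=
  forall (n : nat) (v : 'I_n -> V),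
  exists (N : nat) (c : {ffun 'I_n -> 'I_N} -> W),
  forall a : 'I_n -> rat,
    phi (\sum_i a i *: v i) = \sum_(m : {ffun 'I_n -> 'I_N}) (\prod_i a i ^+ m i) *: c m.

Definition polynomial_functor (C D : qcategory) (F : functor C D) : Prop :=
  forall X Y : qob C,
    @polynomial_map (qhom X Y) (qhom (F X) (F Y)) (@fmap C D F X Y).

Program Definition Vect : qcategory :=
  @QCategory (vectType rat) (fun U V => 'Hom(U, V)) (fun U => \1%VF)
    (fun U V W g f => (g \o f)%VF) _ _ _ _ _.
Next Obligation. exact: comp_lfun1l. Qed.
Next Obligation. exact: comp_lfun1r. Qed.
Next Obligation. exact: comp_lfunA. Qed.
Next Obligation. by rewrite comp_lfunDl comp_lfunZl. Qed.
Next Obligation. by rewrite comp_lfunDr comp_lfunZr. Qed.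

(* [phi] is the sequence of coefficients phi_i(X) of
   F(a id_X) = sum_i phi_i(X) a^i. *)
Definition homogeneous_coefs (C : qcategory) (F : functor C Vect) (X : qob C)
    (phi : nat -> qhom (q := Vect) (F X) (F X)) : Prop :=
  exists N : nat, (forall i, (N <= i)%N -> phi i = 0) /\
    forall a : rat, fmap F (a *: qid X) = \sum_(i < N) a ^+ i *: phi i.

(* F_i X is the image of phi_i(X). *)
Definition bounded_functor (C : qcategory) (F : functor C Vect) : Prop :=
  exists phi : forall X, nat -> qhom (q := Vect) (F X) (F X),
    (forall X, @homogeneous_coefs C F X (phi X)) /\
    exists d : nat, forall i, (d < i)%N ->
      forall X, limg (phi X i : 'Hom(_, _)) = 0%VS.

Definition bounded_polynomial (C : qcategory) (F : functor_cat C Vect) : Prop :=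
  @polynomial_functor C Vect F /\ @bounded_functor C F.

Definition polynomial_functors (C : qcategory) : category :=
  fullsub (@bounded_polynomial C).

Record rep (gT : finGroupType) := Rep {
  rep_space :> vectType rat;
  rep_act : gT -> 'End(rep_space);
  rep_act1 : rep_act 1%g = \1%VF;
  rep_actM : forall g h, rep_act (g * h)%g = (rep_act g \o rep_act h)%VF }.

Definition equivariant (gT : finGroupType) (V W : rep gT) (f : 'Hom(V, W)) :=
  forall g, (f \o rep_act V g)%VF = (rep_act W g \o f)%VF.

Section GradedModules.
Variables (T : Type) (gT : T -> finGroupType).

Definition gmod := forall t : T, rep (gT t).

Record ghom (V W : gmod) := GHom {
  gval :> forall t, 'Hom(V t, W t);
  gvalP : forall t, equivariant (gval t) }.

Lemma ghom_eq V W (f g : ghom V W) : (forall t, f t = g t) -> f = g.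
Proof.
case: f g => [f fP] [g gP] /= fg.
have {}fg : f = g by apply: functional_extensionality_dep.
by subst g; congr GHom; apply: Prop_irrelevance.
Qed.

Section GHomModule.
Variables V W : gmod.

HB.instance Definition _ := gen_eqMixin (ghom V W).
HB.instance Definition _ := gen_choiceMixin (ghom V W).

Program Definition ghom0 : ghom V W := @GHom V W (fun t => 0) _.
Next Obligation. by move=> g; rewrite comp_lfun0l comp_lfun0r. Qed.

Program Definition ghomN (f : ghom V W) : ghom V W :=
  @GHom V W (fun t => - f t) _.
Next Obligation. by move=> g; rewrite comp_lfunNl comp_lfunNr gvalP. Qed.

Program Definition ghomD (f f' : ghom V W) : ghom V W :=
  @GHom V W (fun t => f t + f' t) _.
Next Obligation. by move=> g; rewrite comp_lfunDl comp_lfunDr !gvalP. Qed.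

Program Definition ghomZ (a : rat) (f : ghom V W) : ghom V W :=
  @GHom V W (fun t => a *: f t) _.
Next Obligation. by move=> g; rewrite -comp_lfunZl -comp_lfunZr gvalP. Qed.

Fact ghom_addA : associative ghomD.
Proof. by move=> f g h; apply: ghom_eq => t /=; rewrite addrA. Qed.
Fact ghom_addC : commutative ghomD.
Proof. by move=> f g; apply: ghom_eq => t /=; rewrite addrC. Qed.
Fact ghom_add0 : left_id ghom0 ghomD.
Proof. by move=> f; apply: ghom_eq => t /=; rewrite add0r. Qed.
Fact ghom_addN : left_inverse ghom0 ghomN ghomD.
Proof. by move=> f; apply: ghom_eq => t /=; rewrite addNr. Qed.

HB.instance Definition _ := GRing.isZmodule.Build (ghom V W)
  ghom_addA ghom_addC ghom_add0 ghom_addN.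

Fact ghom_scaleA a b f : ghomZ a (ghomZ b f) = ghomZ (a * b) f.
Proof. by apply: ghom_eq => t /=; rewrite scalerA. Qed.
Fact ghom_scale1 : left_id 1 ghomZ.
Proof. by move=> f; apply: ghom_eq => t /=; rewrite scale1r. Qed.
Fact ghom_scaleDr : right_distributive ghomZ +%R.
Proof. by move=> a f g; apply: ghom_eq => t /=; rewrite scalerDr. Qed.
Fact ghom_scaleDl f : {morph ghomZ^~ f : a b / a + b}.
Proof. by move=> a b; apply: ghom_eq => t /=; rewrite scalerDl. Qed.

HB.instance Definition _ := GRing.Zmodule_isLmodule.Build rat (ghom V W)
  ghom_scaleA ghom_scale1 ghom_scaleDr ghom_scaleDl.

End GHomModule.

Program Definition ghom_id (V : gmod) : ghom V V := @GHom V V (fun t => \1%VF) _.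
Next Obligation. by move=> g; rewrite comp_lfun1l comp_lfun1r. Qed.

Program Definition ghom_comp U V W (g : ghom V W) (f : ghom U V) : ghom U W :=
  @GHom U W (fun t => (g t \o f t)%VF) _.
Next Obligation.
by move=> x; rewrite -comp_lfunA gvalP comp_lfunA gvalP comp_lfunA.
Qed.

Program Definition gmod_cat : qcategory :=
  @QCategory gmod ghom ghom_id ghom_comp _ _ _ _ _.
Next Obligation. by apply: ghom_eq => t; apply: comp_lfun1l. Qed.
Next Obligation. by apply: ghom_eq => t; apply: comp_lfun1r. Qed.
Next Obligation. by apply: ghom_eq => t; apply: comp_lfunA. Qed.
Next Obligation.
by apply: ghom_eq => t /=; rewrite comp_lfunDl comp_lfunZl.
Qed.
Next Obligation.
by apply: ghom_eq => t /=; rewrite comp_lfunDr comp_lfunZr.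
Qed.

End GradedModules.

(* The direct sum of the V(t), i.e. the space of finitely supported elements of
   the product, is spanned by finitely many vectors. *)
Section Bounded.
Variables (T : eqType) (gT : T -> finGroupType).

Definition fin_supported (V : gmod gT) (x : forall t, V t) : Prop :=
  exists s : seq T, forall t, t \notin s -> x t = 0.

Definition bounded_gmod (V : gmod gT) : Prop :=
  exists (n : nat) (b : 'I_n -> forall t, V t),
    (forall i, fin_supported (b i)) /\
    forall x : (forall t, V t), fin_supported x ->
      exists c : 'I_n -> rat, forall t, x t = \sum_i c i *: b i t.

Lemma bounded_gmod_support (V : gmod gT) : bounded_gmod V ->
  exists s : seq T, forall t, t \notin s -> forall v : V t, v = 0.
Proof.
case=> n [b [bfin bspan]].
pose s i := projT1 (cid (bfin i)); have sP i := projT2 (cid (bfin i)).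
exists (flatten [seq s i | i <- enum 'I_n]) => t tNs v.
have [|c /(_ t)] := bspan (dfwith (fun u => 0 : V u) v).
  by exists [:: t] => u; rewrite inE eq_sym => tu; rewrite dfwith_out.
rewrite dfwith_in => ->; apply: big1 => i _.
rewrite sP ?scaler0 //; apply: contra tNs => ts.
by apply/flattenP; exists (s i) => //; apply/map_f; rewrite mem_enum.
Qed.

End Bounded.

Section DirectSum.
Variables (I : finType) (X : I -> vectType rat).

(* Coordinates with respect to the bases [vbasis {: X i}]. *)
Definition dsum : vectType rat := {ffun {i : I & 'I_(\dim {: X i})} -> rat^o}.

Definition dsum_inj_fun i (x : X i) : dsum :=
  [ffun q => \sum_(j < \dim {: X i})
     coord (vbasis {: X i}) j x * (q == Tagged _ j)%:R].

Definition dsum_proj_fun i (t : dsum) : X i :=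
  \sum_(j < \dim {: X i}) t (Tagged _ j) *: (vbasis {: X i})`_j.

Fact dsum_inj_linear i : linear (@dsum_inj_fun i).
Proof.
move=> a x y; apply/ffunP => q; rewrite !ffunE /GRing.scale /= mulr_sumr.
rewrite -big_split /=; apply: eq_bigr => j _.
by rewrite linearD linearZ /= mulrDl mulrA.
Qed.
HB.instance Definition _ i := GRing.isLinear.Build rat (X i) dsum _
  (@dsum_inj_fun i) (@dsum_inj_linear i).

Fact dsum_proj_linear i : linear (@dsum_proj_fun i).
Proof.
move=> a x y; rewrite /dsum_proj_fun scaler_sumr -big_split /=.
by apply: eq_bigr => j _; rewrite !ffunE scalerDl scalerA.
Qed.
HB.instance Definition _ i := GRing.isLinear.Build rat dsum (X i) _
  (@dsum_proj_fun i) (@dsum_proj_linear i).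

Definition dsum_inj i : 'Hom(X i, dsum) := linfun (@dsum_inj_fun i).
Definition dsum_proj i : 'Hom(dsum, X i) := linfun (@dsum_proj_fun i).

Lemma dsum_injK i : (dsum_proj i \o dsum_inj i = \1)%VF.
Proof.
apply/lfunP => x; rewrite comp_lfunE !lfunE /= /dsum_proj_fun.
rewrite [RHS](coord_vbasis (memvf x)); apply: eq_bigr => j _; congr (_ *: _).
rewrite ffunE (bigD1 j) //= eqxx mulr1 big1 ?addr0 // => k kj.
by rewrite eq_Tagged /= eq_sym (negPf kj) mulr0.
Qed.

Lemma dsum_inj_proj0 i j : i != j -> (dsum_proj j \o dsum_inj i = 0)%VF.
Proof.
move=> ij; apply/lfunP => x; rewrite comp_lfunE !lfunE /= /dsum_proj_fun.
rewrite big1 // => k _; rewrite ffunE big1 ?scale0r // => l _.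
case: eqP => [/(congr1 tag)/= ji|]; last by rewrite mulr0.
by rewrite ji eqxx in ij.
Qed.

Lemma dsum_sum : (\sum_i (dsum_inj i \o dsum_proj i) = \1)%VF.
Proof.
apply/lfunP => t; rewrite sum_lfunE lfunE /=; apply/ffunP => -[i k].
rewrite sum_ffunE (bigD1 i) //= big1 ?addr0 => [|j ji].
  rewrite comp_lfunE !lfunE /= ffunE (bigD1 k) //= eqxx mulr1.
  rewrite big1 ?addr0 => [|l lk].
    rewrite /dsum_proj_fun linear_sum /= (bigD1 k) //= linearZ /=.
    rewrite coord_free ?(basis_free (vbasisP _)) // eqxx.
    rewrite big1 ?addr0 => [|l lk]; first by rewrite /GRing.scale /= mulr1.
    rewrite linearZ /= coord_free ?(basis_free (vbasisP _)) //.
    by rewrite -val_eqE /= eq_sym in lk *; rewrite (negPf lk) /= mulr0.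
  by rewrite eq_Tagged /= eq_sym (negPf lk) mulr0.
rewrite comp_lfunE !lfunE /= ffunE big1 // => l _.
case: eqP => [/(congr1 tag)/= ij|]; last by rewrite mulr0.
by rewrite ij eqxx in ji.
Qed.

End DirectSum.

Section Multilinear.
Variables (I : finType) (U : I -> vectType rat).

(* [w] is [a *: u + v] in the i-th slot and all three agree elsewhere. *)
Definition multilinear (T : lmodType rat) (M : (forall i, U i) -> T) : Prop :=
  forall i a (u v w : forall i, U i),
    (forall j, j != i -> u j = w j /\ v j = w j) ->
    w i = a *: u i + v i -> M w = a *: M u + M v.

Definition tensor_basis := {dffun forall i : I, 'I_(\dim {: U i})}.

Definition basis_family (k : tensor_basis) : forall i, U i :=
  fun i => (vbasis {: U i})`_(k i).

(* Coordinates with respect to the tensor products of the vectors of the bases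
   [vbasis {: U i}]. *)
Definition tensor : vectType rat := {ffun tensor_basis -> rat^o}.

Definition pure (u : forall i, U i) : tensor :=
  [ffun k : tensor_basis => \prod_i coord (vbasis {: U i}) (k i) (u i)].

Definition tensor_lift_fun (T : vectType rat) (M : (forall i, U i) -> T)
  (t : tensor) : T := \sum_k t k *: M (basis_family k).

Fact tensor_lift_linear (T : vectType rat) (M : (forall i, U i) -> T) :
  linear (tensor_lift_fun M).
Proof.
move=> a x y; rewrite /tensor_lift_fun scaler_sumr -big_split /=.
by apply: eq_bigr => k _; rewrite !ffunE scalerDl scalerA.
Qed.
HB.instance Definition _ (T : vectType rat) (M : (forall i, U i) -> T) :=
  GRing.isLinear.Build rat tensor T _ (tensor_lift_fun M)
    (tensor_lift_linear M).

(* The linear map sending [pure u] to [M u], for [M] multilinear. *)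
Definition tensor_lift (T : vectType rat) (M : (forall i, U i) -> T) : 'Hom(tensor, T) :=
  linfun (tensor_lift_fun M).

Lemma pure_multilinear : multilinear pure.
Proof.
move=> i a u v w uvw wi; apply/ffunP => k; rewrite !ffunE.
rewrite (bigD1 i) //= [in RHS](bigD1 i) //= [X in _ = _ + X](bigD1 i) //=.
rewrite wi linearD linearZ /= mulrDl /GRing.scale /= -mulrA.
by congr (_ * (_ * _) + _ * _); apply: eq_bigr => j /uvw[uj vj]; rewrite ?uj ?vj.
Qed.

Lemma multilinear_eq (T : lmodType rat) (M L : (forall i, U i) -> T) :
  multilinear M -> multilinear L ->
  (forall k, M (basis_family k) = L (basis_family k)) -> M = L.
Proof.
move=> Mm Lm ML; apply: functional_extensionality_dep.
suff H (s : seq I) u : (forall i, i \notin s ->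
    exists j : 'I_(\dim {: U i}), u i = (vbasis {: U i})`_j) -> M u = L u.
  by move=> u; apply: (H (enum I)) => i; rewrite mem_enum.
elim: s u => [|i s IHs] u uP.
  pose k : tensor_basis := [ffun i => projT1 (cid (uP i isT))].
  rewrite (_ : u = basis_family k) //; apply: functional_extensionality_dep => i.
  by rewrite /basis_family ffunE; exact: projT2 (cid (uP i isT)).
pose f (N : (forall i, U i) -> T) x := N (dfwith u (x : U i)).
have flin N : multilinear N -> linear (f N).
  move=> Nm a x y; apply: (Nm i); last by rewrite !dfwith_in.
  by move=> j ji; rewrite !dfwith_out // eq_sym.
have fsum N (c : 'I_(\dim {: U i}) -> rat) : multilinear N ->
    f N (\sum_j c j *: (vbasis {: U i})`_j) =
    \sum_j c j *: f N (vbasis {: U i})`_j.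
  move=> Nm; pose g := HB.pack_for {linear U i -> T} (f N)
    (GRing.isLinear.Build rat (U i) T _ (f N) (flin N Nm)).
  by rewrite -[f N]/(g : _ -> _) linear_sum; apply: eq_bigr => j _; rewrite linearZ.
have fu N : N u = f N (u i).
  congr N; apply: functional_extensionality_dep => j; by case: dfwithP.
rewrite !fu (coord_vbasis (memvf (u i))) !fsum //.
apply: eq_bigr => j _; congr (_ *: _); apply: IHs => l ls.
have [->|li] := eqVneq l i; first by exists j; rewrite dfwith_in.
by rewrite dfwith_out 1?eq_sym //; apply: uP; rewrite inE negb_or li.
Qed.

Lemma pure_basis k : pure (basis_family k) = [ffun k' => (k' == k)%:R].
Proof.
apply/ffunP => k'; rewrite !ffunE; have [->|kk'] := eqVneq k' k.
  rewrite big1 // => i _.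
  by rewrite coord_free ?(basis_free (vbasisP _)) // eqxx.
have /existsP[i ki] : [exists i, k' i != k i].
  rewrite -negb_forall; apply: contra kk' => /forallP kk.
  by apply/eqP/ffunP => i; apply/eqP.
rewrite (bigD1 i) //= coord_free ?(basis_free (vbasisP _)) //.
by rewrite eq_sym (negPf ki) mul0r.
Qed.

Lemma tensor_decomp (t : tensor) : t = \sum_k t k *: pure (basis_family k).
Proof.
apply/ffunP => k; rewrite sum_ffunE (bigD1 k) //= big1 ?addr0 => [|l lk].
  by rewrite ffunE pure_basis ffunE eqxx /GRing.scale /= mulr1.
by rewrite ffunE pure_basis ffunE eq_sym (negPf lk) scaler0.
Qed.

Lemma tensor_liftE (T : vectType rat) (M : (forall i, U i) -> T) u :
  multilinear M -> tensor_lift M (pure u) = M u.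
Proof.
move=> Mm; rewrite -[LHS]/((fun u => tensor_lift M (pure u)) u).
rewrite (_ : (fun u => _) = M) //; apply: multilinear_eq => // [|k].
  by move=> i a v1 v2 w vw wi; rewrite (pure_multilinear vw wi) linearP.
rewrite lfunE /= /tensor_lift_fun (bigD1 k) //= pure_basis big1 ?addr0.
  by rewrite ffunE eqxx scale1r.
by move=> l lk; rewrite ffunE (negPf lk) scale0r.
Qed.

Lemma tensor_ext (T : vectType rat) (f g : 'Hom(tensor, T)) :
  (forall u, f (pure u) = g (pure u)) -> f = g.
Proof.
move=> fg; apply/lfunP => t; rewrite (tensor_decomp t) !linear_sum.
by apply: eq_bigr => k _; rewrite !linearZ /= fg.
Qed.

End Multilinear.

Section TensorMaps.
Variable I : finType.

Definition tensor_map (U U' : I -> vectType rat)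
    (f : forall i, 'Hom(U i, U' i)) : 'Hom(tensor U, tensor U') :=
  tensor_lift (fun u => pure (fun i => f i (u i))).

Lemma tensor_mapE (U U' : I -> vectType rat) (f : forall i, 'Hom(U i, U' i)) u :
  tensor_map f (pure u) = pure (fun i => f i (u i)).
Proof.
apply: tensor_liftE => i a v1 v2 w vw wi; apply: (@pure_multilinear _ _ i).
  by move=> j /vw[-> ->].
by rewrite wi linearP.
Qed.

Lemma tensor_map_id (U : I -> vectType rat) : tensor_map (fun i => \1%VF : 'End(U i)) = \1%VF.
Proof.
apply: tensor_ext => u; rewrite tensor_mapE id_lfunE; congr pure.
by apply: functional_extensionality_dep => i; rewrite id_lfunE.
Qed.

Lemma tensor_map_comp (U U' U'' : I -> vectType rat) (g : forall i, 'Hom(U' i, U'' i))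
    (f : forall i, 'Hom(U i, U' i)) :
  tensor_map (fun i => (g i \o f i)%VF) = (tensor_map g \o tensor_map f)%VF.
Proof.
apply: tensor_ext => u; rewrite comp_lfunE !tensor_mapE; congr pure.
by apply: functional_extensionality_dep => i; rewrite comp_lfunE.
Qed.

Lemma tensor_map0 (U U' : I -> vectType rat) (f : forall i, 'Hom(U i, U' i)) i :
  f i = 0 -> tensor_map f = 0.
Proof.
move=> fi0; apply: tensor_ext => u; rewrite tensor_mapE zero_lfunE.
apply/ffunP => k; rewrite !ffunE (bigD1 i) //= fi0 zero_lfunE.
by rewrite linear0 mul0r.
Qed.

Variable gT : finGroupType.

Program Definition tensor_rep (V : I -> rep gT) : rep gT :=
  @Rep gT (tensor (fun i => V i)) (fun g => tensor_map (fun i => rep_act (V i) g))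
    _ _.
Next Obligation.
rewrite -tensor_map_id; congr tensor_map.
by apply: functional_extensionality_dep => i; rewrite rep_act1.
Qed.
Next Obligation.
rewrite -tensor_map_comp; congr tensor_map.
by apply: functional_extensionality_dep => i; rewrite rep_actM.
Qed.

Lemma tensor_map_equivariant (V W : I -> rep gT) (f : forall i, 'Hom(V i, W i)) :
  (forall i, equivariant (f i)) ->
  @equivariant gT (tensor_rep V) (tensor_rep W) (tensor_map f).
Proof.
move=> fP g; rewrite /= -!tensor_map_comp; congr tensor_map.
by apply: functional_extensionality_dep => i; rewrite fP.
Qed.

End TensorMaps.

Section Quotients.

(* Quotient spaces are realised on the chosen complement of a subspace. *)
Definition quot (T : vectType rat) (R : {vspace T}) : vectType rat :=
  subvs_of R^C.

Definition quot_pi (T : vectType rat) (R : {vspace T}) : 'Hom(T, quot R) :=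
  (linfun (vsproj R^C) \o daddv_pi R^C R)%VF.

Definition quot_map (T T' : vectType rat) (R : {vspace T}) (R' : {vspace T'})
    (f : 'Hom(T, T')) : 'Hom(quot R, quot R') :=
  (quot_pi R' \o f \o linfun vsval)%VF.

Lemma quot_piE (T : vectType rat) (R : {vspace T}) (x : quot R) :
  quot_pi R (vsval x) = x.
Proof.
rewrite comp_lfunE lfunE /= daddv_pi_id ?vsvalK ?subvsP //.
by rewrite capvC capv_compl.
Qed.

Lemma quot_ker (T : vectType rat) (R : {vspace T}) : lker (quot_pi R) = R.
Proof.
have RC : (R^C :&: R = 0)%VS by rewrite capvC capv_compl.
have CR : (R :&: R^C = 0)%VS by rewrite capv_compl.
have full t : t \in (R^C + R)%VS by rewrite addvC addv_complf memvf.
apply/vspaceP => t; rewrite memv_ker comp_lfunE lfunE /=.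
rewrite -(inj_eq (@subvs_inj _ _ _)) /= vsprojK ?memv_pi //.
rewrite -{2}(daddv_pi_add RC (full t)); apply/eqP/idP => [->|].
  by rewrite add0r memv_pi.
rewrite rpredDr ?memv_pi // => tR; apply/eqP.
by rewrite -memv0 -RC memv_cap memv_pi tR.
Qed.

Lemma quot_mapE (T T' : vectType rat) (R : {vspace T}) (R' : {vspace T'})
    (f : 'Hom(T, T')) : (f @: R <= R')%VS ->
  (quot_map R R' f \o quot_pi R = quot_pi R' \o f)%VF.
Proof.
move=> fR; apply/lfunP => t.
rewrite (comp_lfunE (quot_map _ _ _)) (comp_lfunE (quot_pi R') f) /quot_map.
rewrite comp_lfunE (comp_lfunE (quot_pi R') f) [linfun vsval _]lfunE /=.
apply/eqP; rewrite -subr_eq0 -!linearB -memv_ker quot_ker.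
apply: (subvP fR); apply: memv_img.
by rewrite -(quot_ker R) memv_ker linearB quot_ker /= quot_piE subrr.
Qed.

Lemma quot_ext (T T' : vectType rat) (R : {vspace T}) (f g : 'Hom(quot R, T')) :
  (f \o quot_pi R = g \o quot_pi R)%VF -> f = g.
Proof.
move=> /lfunP fg; apply/lfunP => x.
have := fg (vsval x).
by rewrite (comp_lfunE f) (comp_lfunE g) quot_piE.
Qed.

End Quotients.

Section Coinvariants.
Variable gT : finGroupType.
Implicit Types V W : rep gT.

Definition coinv_rel V : {vspace V} :=
  (\sum_(g : gT) limg (rep_act V g - \1%VF)%R)%VS.

Definition coinv V : vectType rat := quot (coinv_rel V).

Definition coinv_map V W (f : 'Hom(V, W)) : 'Hom(coinv V, coinv W) :=
  quot_map (coinv_rel V) (coinv_rel W) f.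

Lemma coinv_mapE V W (f : 'Hom(V, W)) : equivariant f ->
  (coinv_map f \o quot_pi (coinv_rel V) = quot_pi (coinv_rel W) \o f)%VF.
Proof.
move=> fP; apply: quot_mapE; rewrite limg_sum; apply/subv_sumP => g _.
rewrite -limg_comp comp_lfunDr comp_lfunNr comp_lfun1r fP.
rewrite -{2}[f]comp_lfun1l -comp_lfunNl -comp_lfunDl limg_comp.
by apply: subv_trans (sumv_sup g _ (subvv _)) => //; apply: limgS; apply: subvf.
Qed.

Lemma coinv_map_id V : coinv_map (\1%VF : 'End(V)) = \1%VF.
Proof.
apply: quot_ext; rewrite coinv_mapE; first by rewrite comp_lfun1l comp_lfun1r.
by move=> g; rewrite comp_lfun1l comp_lfun1r.
Qed.

Lemma coinv_map_comp (U V W : rep gT) (g : 'Hom(V, W)) (f : 'Hom(U, V)) :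
  equivariant g -> equivariant f ->
  coinv_map (g \o f)%VF = (coinv_map g \o coinv_map f)%VF.
Proof.
move=> gP fP; apply: quot_ext; rewrite coinv_mapE.
  rewrite comp_lfunA -(coinv_mapE gP) -(comp_lfunA (coinv_map g)).
  by rewrite -(coinv_mapE fP) comp_lfunA.
by move=> x; rewrite -comp_lfunA fP comp_lfunA gP comp_lfunA.
Qed.

Lemma coinv_map0 V W : coinv_map (0 : 'Hom(V, W)) = 0.
Proof. by rewrite /coinv_map /quot_map comp_lfun0r comp_lfun0l. Qed.

(* V (x)_G W: the quotient of V (x) W by the relations gv (x) gw = v (x) w, the
   left module V being a right one through v g = g^-1 v. *)
Definition pair_family (A : Type) (x y : A) (b : bool) : A := if b then x else y.

Definition pair_hom V W V' W' (f : 'Hom(V, V')) (h : 'Hom(W, W')) (b : bool) :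
    'Hom(pair_family V W b, pair_family V' W' b) :=
  match b return 'Hom(pair_family V W b, pair_family V' W' b) with
  | true => f
  | false => h
  end.

Definition btensor V W : vectType rat := coinv (tensor_rep (pair_family V W)).

Definition btensor_map V W V' W' (f : 'Hom(V, V')) (h : 'Hom(W, W')) :
    'Hom(btensor V W, btensor V' W') :=
  @coinv_map (tensor_rep (pair_family V W)) (tensor_rep (pair_family V' W'))
    (tensor_map (pair_hom f h)).

Lemma btensor_map_id V W :
  btensor_map (\1%VF : 'End(V)) (\1%VF : 'End(W)) = \1%VF.
Proof.
rewrite /btensor_map -[RHS]coinv_map_id; congr coinv_map.
rewrite -[RHS]tensor_map_id; congr tensor_map.
by apply: functional_extensionality_dep => -[].
Qed.

Lemma btensor_map_comp V W V' W' V'' W''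
    (f' : 'Hom(V', V'')) (h' : 'Hom(W', W''))
    (f : 'Hom(V, V')) (h : 'Hom(W, W')) :
  equivariant f' -> equivariant h' -> equivariant f -> equivariant h ->
  btensor_map (f' \o f)%VF (h' \o h)%VF =
  (btensor_map f' h' \o btensor_map f h)%VF.
Proof.
move=> ? ? ? ?; rewrite /btensor_map -coinv_map_comp.
- congr coinv_map; rewrite -tensor_map_comp; congr tensor_map.
  by apply: functional_extensionality_dep => -[].
- by apply: tensor_map_equivariant => -[].
- by apply: tensor_map_equivariant => -[].
Qed.

Lemma btensor_map0 V W V' W' (h : 'Hom(W, W')) :
  btensor_map (0 : 'Hom(V, V')) h = 0.
Proof.
by rewrite /btensor_map (@tensor_map0 _ _ _ _ true) // coinv_map0.
Qed.

End Coinvariants.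

Section Wreath.
Variables (gT : finGroupType) (n : nat).

Record wreath := Wreath { wr_base : {ffun 'I_n -> gT}; wr_top : 'S_n }.

Definition wreath_pair (x : wreath) := (wr_base x, wr_top x).
Definition pair_wreath p := Wreath p.1 p.2.
Fact wreath_pairK : cancel wreath_pair pair_wreath. Proof. by case. Qed.

HB.instance Definition _ := Finite.copy wreath (can_type wreath_pairK).

(* MathComp composes permutations from left to right: (s * t) j = t (s j). *)
Definition wreath_mul (x y : wreath) : wreath :=
  Wreath [ffun j => wr_base x j * wr_base y (wr_top x j)]%g
         (wr_top x * wr_top y)%g.
Definition wreath_one : wreath := Wreath [ffun=> 1%g] 1%g.
Definition wreath_inv (x : wreath) : wreath :=
  Wreath [ffun j => (wr_base x ((wr_top x)^-1%g j))^-1%g] (wr_top x)^-1%g.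

Fact wreath_mulA : associative wreath_mul.
Proof.
move=> x y z; congr Wreath; last by rewrite mulgA.
by apply/ffunP => j; rewrite !ffunE permM mulgA.
Qed.
Fact wreath_mul1 : left_id wreath_one wreath_mul.
Proof.
case=> f s; congr Wreath; last by rewrite mul1g.
by apply/ffunP => j; rewrite !ffunE perm1 mul1g.
Qed.
Fact wreath_mulV : left_inverse wreath_one wreath_inv wreath_mul.
Proof.
case=> f s; congr Wreath; last by rewrite mulVg.
by apply/ffunP => j; rewrite !ffunE /= mulVg.
Qed.

HB.instance Definition _ :=
  Finite_isGroup.Build wreath wreath_mulA wreath_mul1 wreath_mulV.

End Wreath.

Definition Part := {fsfun nat -> nat with 0%N}.

(* The factors with nu i = 0 are trivial. *)
Definition Sgrp (nu : Part) : finGroupType :=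
  {dffun forall i : finsupp nu, wreath 'S_(val i) (nu (val i))}.

Definition SVect : qcategory := gmod_cat (fun n : nat => 'S_n).

Section TensorPowers.
Variable nu : Part.
Implicit Types W : qob SVect.

(* The positions (i, j), j < nu i, of the factors of W^{(x) nu}. *)
Definition slot : finType := {i : finsupp nu & 'I_(nu (val i))}.

Definition slot_perm (g : Sgrp nu) (p : slot) : slot :=
  Tagged (fun i : finsupp nu => 'I_(nu (val i)))
    (wr_top (g (tag p)) (tagged p)).

Definition slot_family W (p : slot) : vectType rat := W (val (tag p)).

(* The factor at (i, j) of g . (x) u is the (s j)-th factor of u in degree i,
   acted upon by h j, where (h, s) is the i-th component of g. *)
Definition slot_act W (g : Sgrp nu) (u : forall p, slot_family W p) :
    forall p, slot_family W p :=
  fun p => rep_act (W (val (tag p))) (wr_base (g (tag p)) (tagged p))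
    (u (slot_perm g p)).

Definition tpower_act W (g : Sgrp nu) : 'End(tensor (slot_family W)) :=
  tensor_lift (fun u => pure (slot_act g u)).

Lemma slot_perm_inj g : injective (slot_perm g).
Proof.
case=> i j [i' j'] /= /eqP; rewrite /slot_perm /= -tag_eqE /tag_eq /=.
case/andP => /eqP ii'; subst i'; rewrite tagged_asE => /eqP/perm_inj -> //.
Qed.

Lemma tpower_actE W g (u : forall p, slot_family W p) :
  tpower_act W g (pure u) = pure (slot_act g u).
Proof.
apply: tensor_liftE => q a v1 v2 w vw wq.
have [p pq] : exists p, slot_perm g p = q.
  by exists (invF (@slot_perm_inj g) q); rewrite f_invF.
subst q; apply: (@pure_multilinear _ _ p) => [p' pp'|].
  have [|e1 e2] := vw (slot_perm g p').
    by rewrite (inj_eq (@slot_perm_inj g)).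
  by rewrite /slot_act e1 e2.
by rewrite /slot_act wq linearP.
Qed.

Program Definition tpower W : rep (Sgrp nu) :=
  @Rep (Sgrp nu) (tensor (slot_family W)) (tpower_act W) _ _.
Next Obligation.
apply: tensor_ext => u; rewrite tpower_actE id_lfunE; congr pure.
apply: functional_extensionality_dep => -[i j].
rewrite /slot_act /slot_perm /= ffunE /= ffunE perm1 rep_act1 id_lfunE //.
Qed.
Next Obligation.
apply: tensor_ext => u; rewrite comp_lfunE !tpower_actE; congr pure.
apply: functional_extensionality_dep => -[i j].
by rewrite /slot_act /slot_perm /= ffunE /= ffunE permM rep_actM comp_lfunE.
Qed.

Definition tpower_map W W' (f : qhom W W') : 'Hom(tpower W, tpower W') :=
  tensor_map (fun p : slot => (f : ghom _ _) (val (tag p))).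

Lemma tpower_map_equivariant W W' (f : qhom W W') : equivariant (tpower_map f).
Proof.
move=> g; apply: tensor_ext => u.
rewrite !comp_lfunE /= tpower_actE /tpower_map !tensor_mapE tpower_actE.
congr pure; apply: functional_extensionality_dep => p; rewrite /slot_act.
by rewrite -comp_lfunE gvalP comp_lfunE.
Qed.

Lemma tpower_map_id W : tpower_map (qid W) = \1%VF.
Proof. exact: tensor_map_id. Qed.

Lemma tpower_map_comp W W' W'' (g : qhom W' W'') (f : qhom W W') :
  tpower_map (qcomp g f) = (tpower_map g \o tpower_map f)%VF.
Proof. exact: tensor_map_comp. Qed.

End TensorPowers.

Definition S2Vect : qcategory := gmod_cat Sgrp.

Definition S2Vect_bounded : category :=
  @fullsub S2Vect (fun V => bounded_gmod (V : gmod Sgrp)).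

Section PartSum.
Variables (S : {fset Part}) (X : Part -> vectType rat).

Definition psum : vectType rat := dsum (fun nu : S => X (val nu)).

(* Inclusion and projection for any nu in Part, zero for nu outside S. *)
Definition psum_inj (nu : Part) : 'Hom(X nu, psum) :=
  match pselect (nu \in S) with
  | left nuS => dsum_inj (fun mu : S => X (val mu)) [` nuS]%fset
  | right _ => 0
  end.

Definition psum_proj (nu : Part) : 'Hom(psum, X nu) :=
  match pselect (nu \in S) with
  | left nuS => dsum_proj (fun mu : S => X (val mu)) [` nuS]%fset
  | right _ => 0
  end.

Lemma psum_injK nu : nu \in S -> (psum_proj nu \o psum_inj nu = \1)%VF.
Proof.
move=> nuS; rewrite /psum_proj /psum_inj.
by case: (pselect (nu \in S)) => // h; exact: (dsum_injK (fun mu : S => X (val mu)) [` h]%fset).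
Qed.

Lemma psum_inj_proj0 nu mu : nu != mu -> (psum_proj mu \o psum_inj nu = 0)%VF.
Proof.
move=> nm; rewrite /psum_proj /psum_inj.
case: (pselect (mu \in S)) => [muS|_]; last by rewrite comp_lfun0l.
case: (pselect (nu \in S)) => [nuS|_]; last by rewrite comp_lfun0r.
apply: (@dsum_inj_proj0 _ (fun mu : S => X (val mu)) [` nuS]%fset [` muS]%fset).
by apply: contra nm => /eqP/(congr1 val)/= ->.
Qed.

Lemma psum_inj0 nu : nu \notin S -> psum_inj nu = 0.
Proof.
by move=> nuS; rewrite /psum_inj; case: (pselect (nu \in S)) => // nuS'; rewrite nuS' in nuS.
Qed.

Lemma psum_sum : (\sum_(nu : S) (psum_inj (val nu) \o psum_proj (val nu)) = \1)%VF.
Proof.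
rewrite -[RHS]dsum_sum; apply: eq_bigr => -[nu h] _; rewrite /psum_inj /psum_proj.
by case: pselect => //= nuS; rewrite (bool_irrelevance nuS h).
Qed.

End PartSum.

Section SchurFunctor.
Implicit Types (V : S2Vect_bounded) (W : qob SVect).

Definition support V : {fset Part} :=
  [fset nu in projT1 (cid (bounded_gmod_support (fs_prop V)))]%fset.

Lemma supportP V nu : nu \notin support V ->
  forall v : (fs_ob V : gmod Sgrp) nu, v = 0.
Proof.
rewrite /support; case: cid => s sP /=; rewrite inE; exact: sP.
Qed.

Definition P_term V W (nu : Part) : vectType rat :=
  btensor ((fs_ob V : gmod Sgrp) nu) (tpower nu W).

Definition P_term_map V V' (f : hom V V') W W' (h : qhom W W') (nu : Part) :
    'Hom(P_term V W nu, P_term V' W' nu) :=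
  btensor_map ((f : ghom _ _) nu) (tpower_map nu h).

Definition P_space V W : vectType rat := psum (support V) (P_term V W).

Definition P_map V V' (f : hom V V') W W' (h : qhom W W') :
    'Hom(P_space V W, P_space V' W') :=
  (\sum_(nu : support V)
     (psum_inj (support V') (P_term V' W') (val nu) \o
      P_term_map f h (val nu) \o
      psum_proj (support V) (P_term V W) (val nu)))%VF.

Lemma P_term_map_id V W nu : P_term_map (idm V) (qid W) nu = \1%VF.
Proof. by rewrite /P_term_map tpower_map_id; apply: btensor_map_id. Qed.

Lemma P_term_map_comp V V' V'' (f' : hom V' V'') (f : hom V V') W W' W''
    (h' : qhom W' W'') (h : qhom W W') nu :
  P_term_map (comp f' f) (qcomp h' h) nu =
  (P_term_map f' h' nu \o P_term_map f h nu)%VF.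
Proof.
rewrite /P_term_map tpower_map_comp -btensor_map_comp //.
- exact: gvalP.
- exact: tpower_map_equivariant.
- exact: gvalP.
- exact: tpower_map_equivariant.
Qed.

Lemma P_term_map0 V V' (f : hom V V') W W' (h : qhom W W') nu :
  (nu \notin support V) || (nu \notin support V') -> P_term_map f h nu = 0.
Proof.
move=> nuS; rewrite /P_term_map (_ : (f : ghom _ _) nu = 0) ?btensor_map0 //.
apply/lfunP => v; rewrite zero_lfunE; case/orP: nuS => nuS.
  by rewrite (supportP nuS v) linear0.
exact: supportP.
Qed.

Lemma P_map_id V W : P_map (idm V) (qid W) = \1%VF.
Proof.
rewrite -[RHS]psum_sum; apply: eq_bigr => nu _.
by rewrite P_term_map_id comp_lfun1r.
Qed.

Lemma P_map_inj V V' (f : hom V V') W W' (h : qhom W W') nu :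
  (P_map f h \o psum_inj (support V) (P_term V W) nu =
   psum_inj (support V') (P_term V' W') nu \o P_term_map f h nu)%VF.
Proof.
have [nuS|nuS] := boolP (nu \in support V); last first.
  by rewrite psum_inj0 // P_term_map0 ?nuS // !comp_lfun0r.
apply/lfunP => x; rewrite comp_lfunE sum_lfunE (bigD1 [` nuS]%fset) //=.
rewrite big1 ?addr0 => [|mu muN].
  by rewrite -[LHS]comp_lfunE -(comp_lfunA _ (psum_proj _ _ _)) psum_injK ?comp_lfun1r.
rewrite -[LHS]comp_lfunE -(comp_lfunA _ (psum_proj _ _ _)) psum_inj_proj0 ?comp_lfun0r ?zero_lfunE //.
by apply: contra muN => /eqP e; apply/eqP/val_inj.
Qed.

Lemma P_map_comp V V' V'' (f' : hom V' V'') (f : hom V V') W W' W''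
    (h' : qhom W' W'') (h : qhom W W') :
  P_map (comp f' f) (qcomp h' h) = (P_map f' h' \o P_map f h)%VF.
Proof.
apply/lfunP => x; rewrite [RHS]comp_lfunE.
have P_mapE U U' (k : hom U U') Z Z' (l : qhom Z Z') y : P_map k l y =
    \sum_(nu : support U) (psum_inj (support U') (P_term U' Z') (val nu) \o
      P_term_map k l (val nu) \o psum_proj (support U) (P_term U Z) (val nu))%VF y.
  exact: sum_lfunE.
rewrite (P_mapE _ _ _ _ _ _ x) (P_mapE _ _ f) linear_sum.
apply: eq_bigr => nu _; rewrite -[RHS]comp_lfunE; congr (fun_of_lfun _ x).
rewrite [RHS]comp_lfunA; congr (_ \o _)%VF.
rewrite [RHS]comp_lfunA P_map_inj P_term_map_comp; exact: comp_lfunA.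
Qed.

Program Definition P_functor V : functor SVect Vect :=
  @Functor SVect Vect (P_space V) (fun W W' h => P_map (idm V) h) _ _.
Next Obligation. exact: P_map_id. Qed.
Next Obligation. by rewrite -P_map_comp comp1m. Qed.

Program Definition P_natural V V' (f : hom V V') :
    natural (P_functor V) (P_functor V') :=
  @Natural SVect Vect (P_functor V) (P_functor V') (fun W => P_map f (qid W)) _.
Next Obligation.
by rewrite -!P_map_comp comp1m compm1 qcomp1m qcompm1.
Qed.

Program Definition P_assignment :
    functor S2Vect_bounded (functor_cat SVect Vect) :=
  @Functor S2Vect_bounded (functor_cat SVect Vect) P_functor P_natural _ _.
Next Obligation. by apply: natural_eq => W; apply: P_map_id. Qed.
Next Obligation.
by apply: natural_eq => W /=; rewrite -P_map_comp qcomp1m.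
Qed.

End SchurFunctor.

(* Main.v *)
From HB Require Import structures.
From mathcomp Require Import all_boot all_order all_algebra all_fingroup.
From mathcomp Require Import finmap boolp.
Require Import Defs.

Set Implicit Arguments.
Unset Strict Implicit.
Unset Printing Implicit Defensive.

Import Order.TTheory GRing.Theory Num.Theory.
Local Open Scope ring_scope.

(** The inverse equivalence sends a polynomial functor [F] to its multilinear
    parts.  Let [free nu] be the S-module with one free generator of degree [n]
    for each slot of [nu] of degree [n].  A scalar for each slot gives an
    endomorphism [diag a] of [free nu], and [ML F nu] is the space of the vectors
    [x] of [F (free nu)] with [F (diag a) x = (prod_p a p) x].  The group S_nu
    acts on it through automorphisms of [free nu].

    The unit [eta] sends [v] in [V nu] to the class of the tensor of [v] with the
    generators of [free nu].  It is injective, because a group average recovers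
    [v] from that class ([eta_inj]).  It is onto [ML (P_V) nu], because a tensor
    of translated generators which has degree one in every generator is
    a translate of the tensor of all generators ([eta_surj]).

    The counit [theta] is evaluation.  Since [free nu] is free, a family [w] of
    vectors of [W] indexed by the slots is a map [slift w : free nu -> W], and
    [theta] sends [x (x) w] to [F (slift w) x].  This is multilinear in [w]
    as it is polynomial and, [x] being multilinear, homogeneous of degree one in
    each variable ([fm_slift_multilinear]).  As [theta (eta x) = x], the map
    [theta] is bijective on multilinear parts.  That it is bijective everywhere
    follows from [generation]: each vector [z] of [F W] is a combination of vectors
    [F g (e (F h z))] with [h : W -> free nu], [g : free nu -> W] and [e] a
    projection onto the multilinear vectors which is a combination of maps
    [F (diag a)], hence commutes with natural transformations.  To prove this,
    Maschke's averaging writes the identity of [W] as a sum of maps factoring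
    through free modules of rank one, and polarization expands the value of
    [F] at this sum.

    An S-module may be nonzero in infinitely many degrees, so that this sum is
    infinite; and [ML F] has to be bounded.  Both difficulties are overcome by
    showing that [F W] only depends on finitely many of the [W n]
    ([fm_support]).  The determinant [D a] of the action on [F W] of a sequence [a]
    of scalars is multiplicative and polynomial in [a].  A Cayley-Hamilton argument
    shows that such a [D] does not vanish at the indicator of some finite set of degrees
    ([mult_poly_finite_support]), and then [F] sends the corresponding idempotent
    of [W] to an invertible idempotent, that is to the identity.  For the
    boundedness of [ML F] this is applied to the module with [d] generators in
    each degree, where [d] bounds the degree of [F]: it has all relevant
    [free nu] as retracts. *)

(** * Polynomial functions of finitely many rational variables *)

(** A monomial is encoded as a word, that is a map [col] from a finite set of
    letters to the set of variables: the degree is then the number of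
    letters, and products of sums expand over maps on letters. *)
Definition polyexp (I : finType) (E : lmodType rat) (f : (I -> rat) -> E) :=
  exists (K : finType) (L : K -> finType) (col : forall k, L k -> I) (e : K -> E),
  forall a, f a = \sum_k (\prod_l a (col k l)) *: e k.

Lemma prod_word (I L : finType) (col : L -> I) (a : I -> rat) :
  \prod_l a (col l) = \prod_i a i ^+ #|[pred l | col l == i]|.
Proof.
rewrite (partition_big col xpredT) //=; apply: eq_bigr => i _.
rewrite (eq_bigr (fun=> a i)) ?prodr_const // => l /eqP -> //.
Qed.

Lemma polyexp_mon (I : finType) (E : lmodType rat) (K : finType)
    (m : K -> I -> nat) (e : K -> E) :
  polyexp (fun a => \sum_k (\prod_i a i ^+ m k i) *: e k).
Proof.
exists K, (fun k => {i : I & 'I_(m k i)}), (fun k l => tag l), e => a.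
apply: eq_bigr => k _; congr (_ *: _).
rewrite (eq_bigr (fun i => \prod_(j < m k i) a i)) => [|i _].
  by rewrite (sig_big_dep _ _ (fun i j => a i)).
by rewrite prodr_const card_ord.
Qed.

Lemma polynomial_map_exp (V W : lmodType rat) (phi : V -> W) (I : finType)
    (v : I -> V) :
  polynomial_map phi -> polyexp (fun a => phi (\sum_i a i *: v i)).
Proof.
move=> /(_ _ (fun i : 'I_#|I| => v (enum_val i)))[N [c phiE]].
have := @polyexp_mon I W {ffun 'I_#|I| -> 'I_N} (fun m i => m (enum_rank i)) c.
case=> [K [L [col [e H]]]]; exists K, L, col, e => a.
rewrite -H [LHS](_ : _ = phi (\sum_(i : 'I_#|I|) a (enum_val i) *: v (enum_val i))).
  rewrite phiE; apply: eq_bigr => m _; congr (_ *: _).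
  rewrite [RHS](reindex _ (onW_bij _ (@enum_val_bij I))) /=.
  by apply: eq_bigr => i _; rewrite enum_valK.
by congr phi; rewrite [LHS](reindex _ (onW_bij _ (@enum_val_bij I))).
Qed.

Lemma polyexp_polynomial_map (V W : lmodType rat) (phi : V -> W) :
  (forall n (v : 'I_n -> V), polyexp (fun a => phi (\sum_i a i *: v i))) ->
  polynomial_map phi.
Proof.
move=> phiP n v; have [K [L [col [e phiE]]]] := phiP n v.
pose m k (i : 'I_n) := #|[pred l | col k l == i]|.
pose N := (\max_k #|L k|).+1.
have mN k i : (m k i < N)%N.
  by rewrite ltnS (leq_trans (max_card _)) // (leq_bigmax k).
pose c (mu : {ffun 'I_n -> 'I_N}) := \sum_(k | [ffun i => Ordinal (mN k i)] == mu) e k.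
exists N, c => a; rewrite phiE.
rewrite (partition_big (fun k => [ffun i => Ordinal (mN k i)] : {ffun 'I_n -> 'I_N}) xpredT) //=.
apply: eq_bigr => mu _; rewrite /c scaler_sumr; apply: eq_bigr => k /eqP <-.
by rewrite prod_word; congr (_ *: _); apply: eq_bigr => i _; rewrite ffunE.
Qed.

Lemma polyexp_bound (K : finType) (L : K -> finType) :
  exists N, forall k, (#|L k| < N)%N.
Proof. by exists (\max_k #|L k|).+1 => k; rewrite ltnS (leq_bigmax k). Qed.

(** Inverting the Vandermonde matrix of the nodes 0, ..., N - 1 expresses the
    coefficient of degree [j] as a combination of values. *)
Lemma coef_weights N j : (j < N)%N -> exists w : 'I_N -> rat,
  forall i, (i < N)%N -> \sum_k w k * (k%:R : rat) ^+ i = (i == j)%:R.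
Proof.
move=> jN; pose a : 'rV[rat]_N := \row_k (k : nat)%:R.
pose A := Vandermonde N a.
have Aunit : A \in unitmx.
  rewrite unitmxE det_Vandermonde unitfE; apply/prodf_neq0 => i _.
  apply/prodf_neq0 => k ik; rewrite !mxE subr_eq0 eqr_nat.
  by rewrite neq_ltn ik orbT.
have [w Aw] : exists w : 'cV_N, A *m w = delta_mx (Ordinal jN) 0.
  by exists (invmx A *m delta_mx (Ordinal jN) 0); rewrite mulmxA mulmxV // mul1mx.
exists (fun k => w k 0) => i iN.
have /matrixP/(_ (Ordinal iN) 0) := Aw.
rewrite !mxE eqxx andbT -val_eqE /= => <-.
by apply: eq_bigr => k _; rewrite !mxE mulrC.
Qed.

Lemma poly_coef_eq0 (E : lmodType rat) N (c : 'I_N -> E) :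
  (forall t : rat, \sum_(i < N) t ^+ i *: c i = 0) -> forall i, c i = 0.
Proof.
move=> c0 j; have [w wP] := coef_weights (ltn_ord j).
transitivity (\sum_k w k *: \sum_(i < N) ((k : nat)%:R : rat) ^+ i *: c i).
  symmetry; under eq_bigr => k _ do rewrite scaler_sumr.
  rewrite exchange_big /= (bigD1 j) //= [X in _ + X]big1 ?addr0 => [|i ij].
    by under eq_bigr do rewrite scalerA; rewrite -scaler_suml wP // eqxx scale1r.
  under eq_bigr do rewrite scalerA; rewrite -scaler_suml wP //.
  by rewrite val_eqE (negPf ij) scale0r.
by rewrite big1 // => k _; rewrite c0 scaler0.
Qed.

(** The words in which each variable occurs exactly once. *)
Definition bijb (L I : finType) (col : L -> I) :=
  injectiveb col && (#|L| == #|I|).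

(** Weights and nodes which extract the coefficient of the product of all
    variables from any polynomial of total degree less than [N]. *)
Definition mlweights (I : finType) (N : nat) (K : finType) (w : K -> rat)
    (pt : K -> I -> rat) :=
  forall (L : finType) (col : L -> I), (#|L| < N)%N ->
  \sum_k w k * \prod_l pt k (col l) = (bijb col)%:R.

Lemma bijbP (L I : finType) (col : L -> I) : bijb col ->
  exists2 g : I -> L, cancel col g & cancel g col.
Proof.
case/andP => /injectiveP ci /eqP LI.
have [|g cg gc] := inj_card_bij ci; first by rewrite LI.
by exists g.
Qed.

Lemma bijb_count (L I : finType) (col : L -> I) :
  bijb col = [forall i, #|[pred l | col l == i]| == 1%N].
Proof.
apply/idP/forallP => [/bijbP[g cg gc] i|cP].
  rewrite -(card1 (g i)); apply/eqP/eq_card => l; rewrite !inE.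
  by rewrite -(can2_eq cg gc).
have ci : injective col.
  move=> l l' ll'; have /card1P[l0 l0P] := cP (col l').
  have := l0P l; have := l0P l'; rewrite !inE ll' eqxx.
  by move=> /esym/eqP -> /esym/eqP ->.
apply/andP; split; first exact/injectiveP.
rewrite -(card_codom ci); apply/eqP/eq_card => i; rewrite [RHS]inE.
have /card1P[l lP] := cP i; have := lP l; rewrite !inE eqxx => /eqP <-.
exact: codom_f.
Qed.

(** Multiply the weights for the coefficient of degree one in each variable. *)
Lemma mlweights_exists (I : finType) N : (1 < N)%N ->
  exists K w pt, @mlweights I N K w pt.
Proof.
move=> N1; have [w wP] := coef_weights N1.
exists {ffun I -> 'I_N}, (fun k : {ffun I -> 'I_N} => \prod_i w (k i)), (fun (k : {ffun I -> 'I_N}) i => (k i : nat)%:R).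
move=> L col LN; pose m i := #|[pred l | col l == i]|.
transitivity (\prod_i \sum_(k < N) w k * (k%:R : rat) ^+ m i).
  rewrite bigA_distr_bigA /=; apply: eq_bigr => k _.
  by rewrite (prod_word col (fun i => (k i : nat)%:R)) -big_split.
have mE i : \sum_(k < N) w k * (k%:R : rat) ^+ m i = (m i == 1%N)%:R.
  by rewrite wP // (leq_ltn_trans (max_card _) LN).
under eq_bigr do rewrite mE.
rewrite bijb_count; have [/forallP mP|] := boolP [forall i, m i == 1%N].
  by rewrite big1 // => i _; rewrite (eqP (mP i)).
rewrite negb_forall => /existsP[i mi]; rewrite (bigD1 i) //= /m.
by rewrite (negPf mi) mul0r.
Qed.

Lemma mlweightsE (I : finType) N K w pt (E : lmodType rat)
    (K' : finType) (L : K' -> finType) (col : forall k, L k -> I) (e : K' -> E) :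
  @mlweights I N K w pt -> (forall k, #|L k| < N)%N ->
  \sum_k w k *: (\sum_k' (\prod_l pt k (col k' l)) *: e k') =
  \sum_(k' | bijb (col k')) e k'.
Proof.
move=> wP LN; under eq_bigr do rewrite scaler_sumr.
rewrite exchange_big /= [RHS]big_mkcond; apply: eq_bigr => k' _.
under eq_bigr do rewrite scalerA; rewrite -scaler_suml wP //.
by case: ifP; rewrite ?scale1r ?scale0r.
Qed.

(** Comparing degrees in [t] in [f (t a) = t f a] leaves the words of length
    one only. *)
Lemma polyexp_homog1 (I : finType) (E : lmodType rat) (f : (I -> rat) -> E) :
  polyexp f -> (forall t a, f (fun i => t * a i) = t *: f a) ->
  forall a, f a = \sum_i a i *: f (fun j => (j == i)%:R).
Proof.
case=> K [L [col [e fE]]] ft.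
have [N LN] := polyexp_bound L.
have [//|w wP] := @coef_weights (maxn N 2) 1; first by rewrite leq_maxr.
have f1 a : f a = \sum_(k | #|L k| == 1%N) (\prod_l a (col k l)) *: e k.
  transitivity (\sum_k w k *: f (fun i => k%:R * a i)).
    under eq_bigr do rewrite ft scalerA; rewrite -scaler_suml.
    have := wP 1%N; rewrite leq_maxr => /(_ isT).
    by under eq_bigr do rewrite expr1; move=> ->; rewrite eqxx scale1r.
  under eq_bigr do rewrite fE scaler_sumr.
  rewrite exchange_big /= [RHS]big_mkcond; apply: eq_bigr => k _.
  under eq_bigr => i _ do rewrite big_split /= prodr_const scalerA mulrA.
  rewrite -scaler_suml -mulr_suml wP ?leq_max ?LN //.
  by case: ifP; rewrite ?mul1r // mul0r scale0r.
move=> a; rewrite f1; under [RHS]eq_bigr do rewrite f1 scaler_sumr.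
rewrite exchange_big /=; apply: eq_bigr => k /eqP/mem_card1[l0 l0P].
have prod1 (b : I -> rat) : \prod_l b (col k l) = b (col k l0).
  by rewrite (bigD1 l0) //= big1 ?mulr1 // => l; have := l0P l; rewrite !inE => <-.
under [RHS]eq_bigr => i _ do rewrite (prod1 (fun j => (j == i)%:R)).
rewrite prod1 (bigD1 (col k l0)) //= eqxx scale1r big1 ?addr0 // => i.
by rewrite eq_sym => /negPf ->; rewrite scale0r scaler0.
Qed.

(** Polarization: the words of length [n] contribute to [f 1] through the
    values of [f] at the points whose coordinates are sums of [n] independent
    variables, [j] being added to the coordinate [tau j].  Extracting the
    product of these variables and summing over [tau] counts each word once for
    every bijection of its letters with ['I_n]. *)
Lemma polarization (I : finType) (E : lmodType rat) (f : (I -> rat) -> E)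
    (Q : E -> Prop) :
  polyexp f -> Q 0 -> (forall a x y, Q x -> Q y -> Q (a *: x + y)) ->
  (forall n (tau : {ffun 'I_n -> I}), exists N0, forall N, (N0 <= N)%N ->
    forall K w pt, @mlweights 'I_n N K w pt ->
    Q (\sum_k w k *: f (fun i => \sum_(j | tau j == i) pt k j))) ->
  Q (f (fun=> 1)).
Proof.
case=> K [L [col [e fE]]] Q0 Qlin QP.
have Qsum (J : finType) (P : pred J) (g : J -> E) :
    (forall j, P j -> Q (g j)) -> Q (\sum_(j | P j) g j).
  move=> gP; elim/big_ind: _ => // x y Qx Qy; rewrite -[x]scale1r; exact: Qlin.
have [M LM] := polyexp_bound L.
have -> : f (fun=> 1) = \sum_(n < M) \sum_(k | Ordinal (LM k) == n) e k.
  rewrite fE (partition_big (fun k => Ordinal (LM k)) xpredT) //=.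
  by apply: eq_bigr => n _; apply: eq_bigr => k _; rewrite big1 ?scale1r.
apply: (Qsum) => n _.
pose N0 (tau : {ffun 'I_n -> I}) := projT1 (cid (QP n tau)).
pose N := (maxn M (maxn 2 (\max_tau N0 tau))).
have [|K' [w [pt wP]]] := @mlweights_exists 'I_n N.
  by rewrite !leq_max leqnn orbT.
(* nb is the factorial of n; only nb != 0 matters *)
pose nb := #|[pred s : {ffun 'I_n -> 'I_n} | bijb s]|.
have nb0 : (nb%:R : rat) != 0.
  rewrite pnatr_eq0 -lt0n; apply/card_gt0P; exists [ffun i => i].
  rewrite inE /bijb eqxx andbT; apply/injectiveP => i j; by rewrite !ffunE.
have -> : \sum_(k | Ordinal (LM k) == n) e k = nb%:R^-1 *:
    \sum_(tau : {ffun 'I_n -> I}) \sum_k w k *: f (fun i => \sum_(j | tau j == i) pt k j).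
  apply: (canRL (scalerK nb0)).
  transitivity (\sum_(tau : {ffun 'I_n -> I}) \sum_k
    (\sum_(s : {ffun L k -> 'I_n} | bijb s) [forall l, tau (s l) == col k l]%:R) *: e k).
    rewrite exchange_big /= scaler_sumr big_mkcond; apply: eq_bigr => k _.
    rewrite -scaler_suml exchange_big /=.
    (* a bijection s of the letters determines tau *)
    have s1 (s : {ffun L k -> 'I_n}) : bijb s ->
        \sum_(tau : {ffun 'I_n -> I}) ([forall l, tau (s l) == col k l]%:R : rat) = 1.
      case/bijbP => g sg gs; rewrite (bigD1 [ffun j => col k (g j)]) //=.
      rewrite (_ : [forall l, _]); last first.
        by apply/forallP => l; rewrite ffunE sg.
      rewrite big1 ?addr0 // => tau; apply: contraNeq => tauP; apply/eqP/ffunP => j.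
      rewrite ffunE -{1}[j]gs; apply/eqP.
      have /forallP : [forall l, tau (s l) == col k l].
        by move: tauP; case: [forall l, tau (s l) == col k l]; rewrite // eqxx.
      exact.
    under [in RHS]eq_bigr => s sP do rewrite s1 //.
    case: (eqVneq (Ordinal (LM k)) n) => kn; last first.
      rewrite big1 ?scale0r // => s /andP[_]; rewrite card_ord => /eqP Ln.
      by case/eqP: kn; apply: val_inj.
    congr (_ *: _); rewrite sumr_const; congr (_%:R); symmetry.
    have Ln : #|L k| = n by rewrite -kn.
    (* the words k of length n have as many bijections with 'I_n as 'I_n itself *)
    pose c (s : {ffun 'I_n -> 'I_n}) : {ffun L k -> 'I_n} :=
      [ffun l => s (cast_ord Ln (enum_rank l))].
    pose c' (s : {ffun L k -> 'I_n}) : {ffun 'I_n -> 'I_n} :=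
      [ffun j => s (enum_val (cast_ord (esym Ln) j))].
    have cK : cancel c c'.
      by move=> s; apply/ffunP => j; rewrite !ffunE enum_valK cast_ordKV.
    have cK' : cancel c' c.
      by move=> s; apply/ffunP => j; rewrite !ffunE cast_ordK enum_rankK.
    have cinj s : injective (c s) <-> injective s.
      split=> si i j; last by rewrite !ffunE => /si /cast_ord_inj /enum_rank_inj.
      pose r k := enum_val (cast_ord (esym Ln) k).
      have := @si (r i) (r j).
      by rewrite !ffunE !enum_valK !cast_ordKV => s_inj /s_inj/enum_val_inj/cast_ord_inj.
    transitivity #|c @: [pred s : {ffun 'I_n -> 'I_n} | bijb s]|; last first.
      by rewrite card_imset //; apply: can_inj cK.
    apply: eq_card => s; rewrite -[s]cK' (mem_imset _ _ (can_inj cK)) !inE.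
    rewrite /bijb Ln !card_ord eqxx !andbT.
    by rewrite unfold_in andbT; apply/injectiveP/injectiveP => /cinj.
  apply: eq_bigr => tau _.
  have fE' a : f (fun i => \sum_(j | tau j == i) a j) =
      \sum_(p : {k : K & {ffun L k -> 'I_n}}) (\prod_l a (tagged p l)) *:
         ([forall l, tau (tagged p l) == col (tag p) l]%:R *: e (tag p)).
    rewrite fE.
    transitivity (\sum_k \sum_(s : {ffun L k -> 'I_n}) (\prod_l a (s l)) *:
         ([forall l, tau (s l) == col k l]%:R *: e k)); last first.
      by rewrite (sig_big_dep _ _ (fun k (s : {ffun L k -> 'I_n}) =>
        (\prod_l a (s l)) *: ([forall l, tau (s l) == col k l]%:R *: e k))).
    apply: eq_bigr => k _; rewrite bigA_distr_big_dep scaler_suml big_mkcond /=.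
    apply: eq_bigr => s _; case: ifP => [/familyP sP|/familyP sP].
      rewrite (_ : [forall l, _]) ?scale1r //; apply/forallP => l; exact: sP.
    case: forallP => [sP'|_]; last by rewrite scale0r scaler0.
    by case: sP => l; apply: sP'.
  under [RHS]eq_bigr do rewrite fE'.
  rewrite (@mlweightsE _ _ _ _ _ _ _ (fun p : {k : K & {ffun L k -> 'I_n}} => L (tag p))
    (fun p => tagged p) _ wP).
    transitivity (\sum_k \sum_(s : {ffun L k -> 'I_n} | bijb s)
        ([forall l, tau (s l) == col k l]%:R : rat) *: e k).
      by apply: eq_bigr => k _; rewrite scaler_suml.
    by rewrite (sig_big_dep _ (fun k (s : {ffun L k -> 'I_n}) => bijb s)
      (fun k (s : {ffun L k -> 'I_n}) => [forall l, tau (s l) == col k l]%:R *: e k)).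
  by move=> p; rewrite leq_max LM.
rewrite -[X in Q X]addr0; apply: (Qlin) => //; apply: (Qsum) => tau _.
apply: (projT2 (cid (QP n tau)) N _ _ _ _ wP).
by rewrite !leq_max (leq_bigmax tau) !orbT.
Qed.

(** * Multiplicative polynomial functions of a sequence *)

Lemma poly_nat_roots (p : {poly rat}) : p != 0 ->
  exists M, forall n, (M <= n)%N -> p.[n%:R] != 0.
Proof.
have [k] := ubnP (size p); elim: k p => // k IHk p pk p0.
have [[n /eqP pn]|noroot] := pselect (exists n : nat, p.[n%:R] == 0); last first.
  by exists 0%N => n _; apply/negP => pn; apply: noroot; exists n.
have /factor_theorem[q pE] : root p n%:R by apply/rootP.
have q0 : q != 0 by apply: contraNneq p0 => q0; rewrite pE q0 mul0r.
have [|M qM] := IHk q _ q0.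
  by move: pk; rewrite pE size_mul ?polyXsubC_eq0 // size_XsubC addn2.
exists (maxn M n.+1) => m; rewrite geq_max => /andP[/qM qm nm].
by rewrite pE hornerM mulf_neq0 // hornerXsubC subr_eq0 eqr_nat neq_ltn nm orbT.
Qed.

Lemma poly_nat_ext (p q : {poly rat}) M :
  (forall n, (M <= n)%N -> p.[n%:R] = q.[n%:R]) -> p = q.
Proof.
move=> pq; apply/eqP; rewrite -subr_eq0; apply/negPn/negP => /poly_nat_roots[M' /(_ (maxn M M'))].
by rewrite leq_maxr hornerD hornerN pq ?leq_maxl // subrr eqxx => /(_ isT).
Qed.

(** The example to keep in mind is the determinant of the action of a sequence of scalars [a] on
    the value of a polynomial functor. *)
Record mult_poly (D : (nat -> rat) -> rat) : Prop := MultPoly {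
  mp1 : D (fun=> 1) = 1;
  mpM : forall a b, D (fun n => a n * b n) = D a * D b;
  mp_poly : forall (beta : nat -> {poly rat}) s, (forall n, (size (beta n) <= s)%N) ->
    exists p : {poly rat}, forall c, D (fun n => (beta n).[c]) = p.[c] }.

Lemma mp_unit D a : mult_poly D -> (forall n, a n != 0) -> D a != 0.
Proof.
move=> DP a0; have : D a * D (fun n => (a n)^-1) != 0.
  rewrite -(mpM DP) (_ : (fun n => _) = fun=> 1) ?(mp1 DP) ?oner_eq0 //.
  by apply: funext => n; rewrite mulfV.
by apply: contraNneq => ->; rewrite mul0r.
Qed.

(** A Cayley-Hamilton theorem.  Let [p] be the polynomial [c |-> D (x - c)],
    where [x] is the sequence of the natural numbers.  As [p x - p c] is divisible by [x - c],
    the polynomial [q : s |-> D (p x - s)] satisfies [q (p c) = p c * r c] for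
    some polynomial [r], so that the non-constant polynomial [p] divides [q 0]. *)
Lemma mult_poly_Cayley_Hamilton D : mult_poly D -> D (fun=> 0) = 0 ->
  exists p : {poly rat}, (forall c, D (fun n => n%:R - c) = p.[c]) /\
    D (fun n => p.[n%:R]) = 0.
Proof.
move=> DP D0.
have [|p pE] := mp_poly DP (beta := fun n => n%:R%:P - 'X) (s := 2).
  by move=> n; rewrite -opprB size_polyN size_XsubC.
have {}pE c : D (fun n => n%:R - c) = p.[c].
  by rewrite -pE; congr D; apply: funext => n; rewrite !hornerE.
exists p; split=> //.
have [|q qE] := mp_poly DP (beta := fun n => p.[n%:R]%:P - 'X) (s := 2).
  by move=> n; rewrite -opprB size_polyN size_XsubC.
have gP n : exists g : {poly rat}, p.[n%:R]%:P - p = g * (n%:R%:P - 'X).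
  have /factor_theorem[g gE] : root (p.[n%:R]%:P - p) n%:R.
    by rewrite /root !hornerE subrr.
  by exists (- g); rewrite gE -opprB mulrN mulNr.
pose g n := projT1 (cid (gP n)); have gE n := projT2 (cid (gP n)).
have [|r rE] := mp_poly DP (beta := g) (s := size p).
  move=> n; have [->|gn0] := eqVneq (g n) 0; first by rewrite size_poly0.
  have : (size (p.[n%:R]%:P - p)%R <= maxn 1 (size p))%N.
    by rewrite (leq_trans (size_polyD _ _)) // size_polyN geq_max !leq_max size_polyC leq_b1 leqnn orbT.
  rewrite gE -/(g n) -opprB mulrN size_polyN size_mul ?polyXsubC_eq0 // size_XsubC addn2 /= leq_max.
  case/orP => [|/ltnW //]; rewrite ltnS leqn0 size_poly_eq0 (negPf gn0) //.
have qp : q \Po p = p * r.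
  apply: (@poly_nat_ext _ _ 0%N) => c _; rewrite horner_comp hornerM -qE -[in RHS]pE -rE -(mpM DP).
  congr D; apply: funext => n; rewrite !hornerE -/(g n).
  by have /(congr1 (fun h => h.[c%:R])) := gE n; rewrite -/(g n) !hornerE mulrC.
(* Since c x - 1 = c (x - c^-1), if p were constant then D (c x - 1) would be
   proportional to D c; but at c = 0 the former is not zero and the latter is. *)
have p1 : (1 < size p)%N.
  rewrite ltnNge; apply/negP => /size1_polyC pk.
  have [|d dE] := mp_poly DP (beta := fun n => 'X) (s := 2).
    by move=> n; rewrite size_polyX.
  have [|p' p'E] := mp_poly DP (beta := fun n => n%:R *: 'X - 1) (s := 2).
    move=> n; rewrite (leq_trans (size_polyD _ _)) // size_polyN size_poly1 geq_max.
    by rewrite (leq_trans (size_scale_leq _ _)) ?size_polyX.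
  have : p' = p`_0 *: d.
    apply: (@poly_nat_ext _ _ 1%N) => n n0; rewrite hornerZ -dE -p'E.
    have n1 : n%:R != 0 :> rat by rewrite pnatr_eq0 -lt0n.
    rewrite -[p`_0](hornerC _ n%:R^-1) -pk -pE -(mpM DP).
    by congr D; apply: funext => m; rewrite !hornerE /= mulrBl mulVf.
  move/(congr1 (fun h => h.[0])); rewrite hornerZ -dE -p'E.
  rewrite [X in _ * D X](_ : _ = fun=> 0); last by apply: funext => n; rewrite hornerX.
  rewrite D0 mulr0; apply/eqP; apply: mp_unit => // n.
  by rewrite !hornerE ?mulr0 ?sub0r oppr_eq0 oner_eq0.
have : p %| (q.[0])%:P.
  have : p %| q \Po p by rewrite qp dvdp_mulIl.
  have /factor_theorem[h hE] : root (q - q.[0]%:P) 0 by rewrite /root !hornerE subrr.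
  rewrite -[q in q \Po p](subrK q.[0]%:P) hE subr0 comp_polyD comp_polyM.
  by rewrite comp_polyX comp_polyC dvdp_addr // dvdp_mulIr.
have <- : q.[0] = D (fun n => p.[n%:R]).
  by rewrite -qE; congr D; apply: funext => n; rewrite !hornerE ?subr0 ?oppr0 ?addr0.
move=> pq; apply/eqP; apply: contraTT pq => q0; rewrite gtNdvdp ?polyC_eq0 //.
by rewrite size_polyC q0.
Qed.

(** If [D] vanished on all finitely supported indicators then replacing
    the first coordinates by 1 would give a function [D'] with [D' 0 = 0], whose
    characteristic polynomial [p'] could only vanish at integers in
    the range of the replaced coordinates; so [D' (p' x) != 0], against
    the Cayley-Hamilton theorem. *)
Lemma mult_poly_finite_support D : mult_poly D ->
  exists M, D (fun n => (n < M)%N%:R) != 0.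
Proof.
move=> DP.
have [|p pE] := mp_poly DP (beta := fun n => n%:R%:P - 'X) (s := 2).
  by move=> n; rewrite -opprB size_polyN size_XsubC.
have {}pE c : D (fun n => n%:R - c) = p.[c].
  by rewrite -pE; congr D; apply: funext => n; rewrite !hornerE.
have [|M pM] := @poly_nat_roots p.
  apply: contraPneq (pE (-1)) => ->; rewrite horner0; apply/eqP; apply: mp_unit => // n.
  by rewrite opprK -(natrD _ n 1) pnatr_eq0 addn1.
exists M; apply/negP => /eqP DM.
pose D' a := D (fun n => if (n < M)%N then 1 else a n).
have DP' : mult_poly D'.
  split.
  - by rewrite /D' -[RHS](mp1 DP); congr D; apply: funext => n; case: ifP.
  - move=> a b; rewrite /D' -(mpM DP); congr D; apply: funext => n.
    by case: ifP => //; rewrite mulr1.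
  - move=> beta s bs.
    have [|p' p'E] := mp_poly DP (beta := fun n => if (n < M)%N then 1 else beta n) (s := maxn 1 s).
      by move=> n; case: ifP; rewrite leq_max ?size_poly1 // bs orbT.
    exists p' => c; rewrite -p'E; congr D; apply: funext => n.
    by case: ifP; rewrite ?hornerC.
have [|p' [p'E]] := mult_poly_Cayley_Hamilton DP'.
  rewrite /D' -[RHS]DM; congr D; apply: funext => n; by case: ifP.
apply/eqP; rewrite /D'; apply: mp_unit => // n; case: ltnP => [_|nM]; first exact: oner_neq0.
have := pM n nM; rewrite -pE -p'E; apply: contraNneq => D'0.
rewrite (_ : (fun m : nat => _) = (fun m => (if (m < M)%N then m%:R - n%:R else 1) *
   (if (m < M)%N then 1 else m%:R - n%:R))).
  by rewrite (mpM DP) -/(D' (fun m => m%:R - n%:R)) D'0 mulr0.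
by apply: funext => m; case: ifP; rewrite ?mulr1 ?mul1r.
Qed.

(** * Elements of tensor products, coinvariants and direct sums *)

Lemma pure_scale (I : finType) (U : I -> vectType rat) (a : I -> rat)
    (u : forall i, U i) :
  pure (fun i => a i *: u i) = (\prod_i a i) *: pure u.
Proof.
apply/ffunP => k; rewrite !ffunE /GRing.scale /= -big_split /=.
by apply: eq_bigr => i _; rewrite linearZ.
Qed.

Lemma pure_sum (I J : finType) (U : I -> vectType rat) (u : forall i, J -> U i) :
  pure (fun i => \sum_j u i j) = \sum_(t : {ffun I -> J}) pure (fun i => u i (t i)).
Proof.
apply/ffunP => k; rewrite sum_ffunE ffunE.
under eq_bigr do rewrite linear_sum.
by rewrite bigA_distr_bigA /=; apply: eq_bigr => t _; rewrite ffunE.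
Qed.

(** The map induced by [M] on the quotient is its restriction to the chosen
    complement of [R]. *)
Lemma quot_lift (T T' : vectType rat) (R : {vspace T}) (M : 'Hom(T, T')) :
  (R <= lker M)%VS -> ((M \o linfun vsval) \o quot_pi R)%VF = M.
Proof.
move=> MR; apply/lfunP => t; rewrite (comp_lfunE _ (quot_pi R)) comp_lfunE.
rewrite [linfun vsval _]lfunE /=; apply/eqP; rewrite -subr_eq0 -linearB -memv_ker.
apply: (subvP MR); by rewrite -(quot_ker R) memv_ker linearB quot_ker /= quot_piE subrr.
Qed.

Section BalancedTensors.
Variable gT : finGroupType.
Implicit Types (V W : rep gT) (T : vectType rat).

Definition pair_vec V W (v : V) (w : W) (b : bool) : pair_family V W b :=
  match b return pair_family V W b with true => v | false => w end.

Definition bpure V W (v : V) (w : W) : btensor V W :=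
  quot_pi (coinv_rel (tensor_rep (pair_family V W)))
    (pure (pair_vec v w : forall b, rep_space (pair_family V W b))).

Lemma pair_vec_eta V W (z : forall b, pair_family V W b) :
  z = pair_vec (z true) (z false).
Proof. by apply: functional_extensionality_dep => -[]. Qed.

Lemma bpure_linearl V W a (v v' : V) (w : W) :
  bpure (a *: v + v') w = a *: bpure v w + bpure v' w.
Proof.
rewrite /bpure -linearP; congr (_ _).
by apply: (@pure_multilinear _ _ true) => // -[].
Qed.

Lemma bpure_linearr V W a (v : V) (w w' : W) :
  bpure v (a *: w + w') = a *: bpure v w + bpure v w'.
Proof.
rewrite /bpure -linearP; congr (_ _).
by apply: (@pure_multilinear _ _ false) => // -[].
Qed.

Lemma bpure_act V W g (v : V) (w : W) : bpure (rep_act V g v) (rep_act W g w) = bpure v w.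
Proof.
rewrite /bpure; apply/eqP; rewrite -subr_eq0 -linearB -memv_ker quot_ker.
pose u := pure (pair_vec v w : forall b, rep_space (pair_family V W b)).
have -> : pure (pair_vec (rep_act V g v) (rep_act W g w)
    : forall b, rep_space (pair_family V W b)) =
    rep_act (tensor_rep (pair_family V W)) g u.
  by rewrite /u /= tensor_mapE; congr pure; apply: functional_extensionality_dep => -[].
rewrite (_ : _ - _ = (rep_act (tensor_rep (pair_family V W)) g - \1%VF)%R u).
  by apply: (subvP (sumv_sup g _ (subvv _))) => //; apply: memv_img; apply: memvf.
by rewrite add_lfunE opp_lfunE id_lfunE.
Qed.

Lemma bpure_ext V W T (f g : 'Hom(btensor V W, T)) :
  (forall v w, f (bpure v w) = g (bpure v w)) -> f = g.
Proof.
move=> fg; apply: quot_ext; apply: tensor_ext => u.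
rewrite (comp_lfunE f) (comp_lfunE g) (pair_vec_eta u); exact: fg.
Qed.

Definition bpure_lift V W T (B : V -> W -> T) : 'Hom(btensor V W, T) :=
  (tensor_lift (fun z : forall b, rep_space (pair_family V W b) =>
     B (z true) (z false)) \o linfun vsval)%VF.

Lemma bpure_liftE V W T (B : V -> W -> T) :
  (forall w, linear (B^~ w)) -> (forall v, linear (B v)) ->
  (forall g v w, B (rep_act V g v) (rep_act W g w) = B v w) ->
  forall v w, bpure_lift B (bpure v w) = B v w.
Proof.
move=> Bl Br BG v w; set R := tensor_rep (pair_family V W).
rewrite /bpure_lift; set M := tensor_lift _.
have Mp z : M (pure z) = B (z true) (z false).
  rewrite /M tensor_liftE // => -[] a u1 u2 z' uz zi.
    have [//|e1 e2] := uz false; rewrite e1 e2 zi; exact: Bl.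
  by have [//|e1 e2] := uz true; rewrite e1 e2 zi; apply: Br.
have MR : (coinv_rel R <= lker M)%VS.
  apply/subv_sumP => g _; apply/subvP => _ /memv_imgP[t _ ->].
  have Mg : (M \o rep_act R g)%VF = M.
    by apply: tensor_ext => z; rewrite comp_lfunE tensor_mapE !Mp BG.
  rewrite memv_ker add_lfunE opp_lfunE id_lfunE linearB /=.
  by rewrite -(comp_lfunE M) Mg subrr.
have := congr1 (fun h : 'Hom(R, T) => h (pure (pair_vec v w : forall b, rep_space (pair_family V W b))))
  (quot_lift MR).
by rewrite comp_lfunE Mp.
Qed.

Lemma btensor_map_bpure V W V' W' (f : 'Hom(V, V')) (h : 'Hom(W, W')) v w :
  equivariant f -> equivariant h -> btensor_map f h (bpure v w) = bpure (f v) (h w).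
Proof.
move=> fE hE; rewrite /btensor_map /bpure -(comp_lfunE (coinv_map _)) coinv_mapE.
  rewrite (comp_lfunE (quot_pi _)) tensor_mapE; congr (_ (pure _)).
  by apply: functional_extensionality_dep => -[].
by apply: tensor_map_equivariant => -[].
Qed.

Lemma tensor_map_pair_sum V W V' W' (f : 'Hom(V, V')) (K : finType) (c : K -> rat)
    (h : K -> 'Hom(W, W')) :
  tensor_map (pair_hom f (\sum_k c k *: h k)) = \sum_k c k *: tensor_map (pair_hom f (h k)).
Proof.
apply: tensor_ext => u; rewrite tensor_mapE sum_lfunE.
under [RHS]eq_bigr do rewrite scale_lfunE tensor_mapE.
apply/ffunP => k; rewrite sum_ffunE ffunE (bigD1 false) //= sum_lfunE linear_sum mulr_suml.
apply: eq_bigr => j _; rewrite !ffunE scale_lfunE linearZ /= /GRing.scale /= -mulrA.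
congr (_ * _); rewrite [RHS](bigD1 false) //=; congr (_ * _).
by apply: eq_bigr => -[].
Qed.

Lemma btensor_map_sum V W V' W' (f : 'Hom(V, V')) (K : finType) (c : K -> rat)
    (h : K -> 'Hom(W, W')) :
  btensor_map f (\sum_k c k *: h k) = \sum_k c k *: btensor_map f (h k).
Proof.
rewrite /btensor_map tensor_map_pair_sum.
have cE U U' (g : 'Hom(rep_space U, rep_space U')) (x : coinv U) :
    coinv_map g x = quot_pi (coinv_rel U') (g (vsval x)).
  by rewrite /coinv_map /quot_map comp_lfunE (comp_lfunE (quot_pi _)) [linfun vsval _]lfunE.
apply/lfunP => x; rewrite cE !sum_lfunE linear_sum.
by apply: eq_bigr => k _; rewrite !scale_lfunE linearZ /= cE.
Qed.

End BalancedTensors.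

(** * Schur functors are polynomial and bounded *)

Lemma comp_lfun_sum (U U' T T' : vectType rat) (A : 'Hom(T, T')) (K : finType)
    (c : K -> rat) (B : K -> 'Hom(U', T)) (C : 'Hom(U, U')) :
  (A \o (\sum_k c k *: B k) \o C)%VF = \sum_k c k *: (A \o B k \o C)%VF.
Proof.
apply/lfunP => x; rewrite !comp_lfunE !sum_lfunE linear_sum.
by apply: eq_bigr => k _; rewrite !scale_lfunE linearZ /= !comp_lfunE.
Qed.

Lemma ghom_sumE (T : Type) (gT : T -> finGroupType) (V W : gmod gT) (I : finType)
    (a : I -> rat) (h : I -> ghom V W) t (x : V t) :
  (\sum_i a i *: h i : ghom V W) t x = \sum_i a i *: h i t x.
Proof.
elim/big_ind2: _ => [|y1 f1 y2 f2 <- <-|i _]; first by rewrite zero_lfunE.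
  by rewrite add_lfunE.
by rewrite scale_lfunE.
Qed.

Lemma tpower_map_sum nu (W W' : qob SVect) (I : finType) (a : I -> rat)
    (h : I -> ghom W W') :
  tpower_map nu (\sum_i a i *: h i : ghom W W') =
  \sum_(t : {ffun slot nu -> I}) (\prod_p a (t p)) *:
    tensor_map (fun p : slot nu => h (t p) (val (tag p))).
Proof.
apply: tensor_ext => u; rewrite /tpower_map tensor_mapE sum_lfunE.
under [RHS]eq_bigr do rewrite scale_lfunE tensor_mapE -pure_scale.
rewrite -(pure_sum (fun p i => a i *: h i (val (tag p)) (u p))).
congr pure; apply: functional_extensionality_dep => p; exact: ghom_sumE.
Qed.

Section SchurElements.
Implicit Types (V : S2Vect_bounded) (W : qob SVect) (T : vectType rat).

Definition part V (nu : Part) : rep (Sgrp nu) := (fs_ob V : gmod Sgrp) nu.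

(** The tensors [v (x) t] span [P_space V W]: [P_ext] and [P_lift] below are the two
    halves of its universal property. *)
Definition ptens V W (nu : Part) (v : part V nu) (t : tpower nu W) : P_space V W :=
  psum_inj (support V) (P_term V W) nu (bpure v t).
Arguments ptens : clear implicits.

Lemma ptens_linearl V W nu a v v' t :
  ptens V W nu (a *: v + v') t = a *: ptens V W nu v t + ptens V W nu v' t.
Proof. by rewrite /ptens bpure_linearl linearP. Qed.

Lemma ptens_linearr V W nu a v t t' :
  ptens V W nu v (a *: t + t') = a *: ptens V W nu v t + ptens V W nu v t'.
Proof. by rewrite /ptens bpure_linearr linearP. Qed.

Lemma ptensZr V W nu a v t : ptens V W nu v (a *: t) = a *: ptens V W nu v t.
Proof.
have t0 : ptens V W nu v 0 = 0.
  by apply/(addrI (ptens V W nu v 0)); rewrite -{1}[ptens V W nu v 0]scale1r -ptens_linearr scale1r !addr0.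
by rewrite -[a *: t]addr0 ptens_linearr t0 addr0.
Qed.

Lemma ptens_act V W nu g v t :
  ptens V W nu (rep_act _ g v) (rep_act (tpower nu W) g t) = ptens V W nu v t.
Proof. by rewrite /ptens bpure_act. Qed.

Lemma part0 V nu (v : part V nu) : nu \notin support V -> v = 0.
Proof. by move=> nuV; apply: (supportP nuV). Qed.

Lemma ptens_notin V W nu v t : nu \notin support V -> ptens V W nu v t = 0.
Proof. by move=> nuV; rewrite /ptens psum_inj0 // zero_lfunE. Qed.

Lemma P_ext V W T (f g : 'Hom(P_space V W, T)) :
  (forall nu v (u : forall p, slot_family W p),
     f (ptens V W nu v (pure u)) = g (ptens V W nu v (pure u))) -> f = g.
Proof.
move=> fg; rewrite -[f]comp_lfun1r -[g]comp_lfun1r -psum_sum.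
apply/lfunP => x; rewrite !comp_lfunE sum_lfunE !linear_sum.
apply: eq_bigr => nu _; rewrite comp_lfunE.
suff /lfunP/(_ (psum_proj (support V) (P_term V W) (val nu) x)) :
    (f \o psum_inj (support V) (P_term V W) (val nu) =
     g \o psum_inj (support V) (P_term V W) (val nu))%VF by rewrite !comp_lfunE.
apply: bpure_ext => v t.
rewrite (tensor_decomp t); elim/big_rec: _ => [|k s _ IH].
  have := bpure_linearr (-1) v (0 : tpower (val nu) W) 0.
  by rewrite scaler0 addr0 scaleN1r addNr => ->; rewrite !linear0.
rewrite bpure_linearr !linearP /= IH; congr (_ *: _ + _).
by rewrite !comp_lfunE; apply: fg.
Qed.

Lemma P_ext_fun V W T (f g : P_space V W -> T) : linear f -> linear g ->
  (forall nu v (u : forall p, slot_family W p),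
     f (ptens V W nu v (pure u)) = g (ptens V W nu v (pure u))) -> f =1 g.
Proof.
move=> fl gl fg.
pose f' := HB.pack_for {linear P_space V W -> T} f
  (GRing.isLinear.Build rat (P_space V W) T _ f fl).
pose g' := HB.pack_for {linear P_space V W -> T} g
  (GRing.isLinear.Build rat (P_space V W) T _ g gl).
have /lfunP fg' : linfun f' = linfun g'.
  by apply: P_ext => nu v u; rewrite !lfunE; apply: fg.
by move=> z; have := fg' z; rewrite !lfunE.
Qed.

(** Each component [phi nu] with [nu] outside the support has a zero source. *)
Definition P_lift V W T (phi : forall nu, 'Hom(P_term V W nu, T)) :
    'Hom(P_space V W, T) :=
  (\sum_(nu : support V) (phi (val nu) \o psum_proj (support V) (P_term V W) (val nu)))%VF.

Lemma P_liftE V W T (phi : forall nu, 'Hom(P_term V W nu, T)) nu v t :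
  P_lift phi (ptens V W nu v t) = phi nu (bpure v t).
Proof.
have [nuV|nuV] := boolP (nu \in support V); last first.
  rewrite ptens_notin // linear0 (part0 v nuV).
  have := bpure_linearl (-1) (0 : part V nu) (0 : part V nu) t.
  by rewrite scaler0 addr0 scaleN1r addNr => ->; rewrite linear0.
rewrite sum_lfunE (bigD1 [` nuV]%fset) //= big1 ?addr0 => [|mu muN].
  by rewrite comp_lfunE -(comp_lfunE (psum_proj _ _ _)) psum_injK // id_lfunE.
rewrite comp_lfunE -(comp_lfunE (psum_proj _ _ _)) psum_inj_proj0 ?zero_lfunE ?linear0 //.
by apply: contra muN => /eqP e; apply/eqP/val_inj.
Qed.

Lemma P_mapE V V' (f : hom V V') W W' (h : qhom W W') nu v t :
  P_map f h (ptens V W nu v t) =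
  ptens V' W' nu ((f : ghom _ _) nu v) (tpower_map nu h t).
Proof.
rewrite /ptens -comp_lfunE P_map_inj comp_lfunE; congr (_ _).
by apply: btensor_map_bpure; [apply: gvalP | apply: tpower_map_equivariant].
Qed.

Lemma P_mapE_pure V V' (f : hom V V') W W' (h : qhom W W') nu v
    (u : forall p : slot nu, slot_family W p) :
  P_map f h (ptens V W nu v (pure u)) =
  ptens V' W' nu ((f : ghom _ _) nu v)
    (pure (fun p => (h : ghom _ _) (val (tag p)) (u p))).
Proof. by rewrite P_mapE /tpower_map tensor_mapE. Qed.

Lemma P_polynomial V : @polynomial_functor SVect Vect (P_functor V).
Proof.
move=> W W'; apply: polyexp_polynomial_map => n h.
pose K : finType := {nu : support V & {ffun slot (val nu) -> 'I_n}}.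
pose E (k : K) : 'Hom(P_space V W, P_space V W') :=
  (psum_inj (support V) (P_term V W') (val (tag k)) \o
   btensor_map ((idm V : ghom _ _) (val (tag k)))
     (tensor_map (fun p : slot (val (tag k)) => (h (tagged k p) : ghom _ _) (val (tag p)))
       : 'Hom(tpower (val (tag k)) W, tpower (val (tag k)) W')) \o
   psum_proj (support V) (P_term V W) (val (tag k)))%VF.
exists K, (fun k => slot (val (tag k))), (fun (k : K) p => (tagged k : {ffun slot (val (tag k)) -> 'I_n}) p), E => a.
transitivity (\sum_(nu : support V) \sum_(t : {ffun slot (val nu) -> 'I_n})
  (\prod_p a (t p)) *: E (Tagged _ t)); last first.
  rewrite (sig_big_dep _ _ (fun (nu : support V) (t : {ffun slot (val nu) -> 'I_n}) =>
    (\prod_p a (t p)) *: E (Tagged _ t))) /=.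
  by apply: eq_bigr => -[].
apply: eq_bigr => nu _.
by rewrite /P_term_map [tpower_map _ _]tpower_map_sum btensor_map_sum comp_lfun_sum.
Qed.

Lemma P_bounded V : @bounded_functor SVect (P_functor V).
Proof.
pose size_part (nu : Part) := #|slot nu|.
pose phi W i : 'Hom(P_space V W, P_space V W) :=
  (\sum_(nu : support V | size_part (val nu) == i)
     (psum_inj (support V) (P_term V W) (val nu) \o
      psum_proj (support V) (P_term V W) (val nu)))%VF.
pose N := (\max_(nu : support V) size_part (val nu)).+1.
have phi0 W i : (N <= i)%N -> phi W i = 0.
  move=> Ni; rewrite /phi big1 // => nu /eqP nui.
  by move: Ni; rewrite -nui ltnNge (leq_bigmax nu).
exists phi; split; last first.
  by exists N => i /ltnW /phi0 phi0i W; rewrite phi0i; apply/eqP; rewrite -lkerE; apply/subvP => x _; rewrite memv_ker zero_lfunE.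
move=> W; exists N; split=> [|a]; first exact: phi0.
have sN (nu : support V) : (size_part (val nu) < N)%N by rewrite ltnS (leq_bigmax nu).
transitivity (\sum_(nu : support V) a ^+ size_part (val nu) *:
   (psum_inj (support V) (P_term V W) (val nu) \o
      psum_proj (support V) (P_term V W) (val nu))%VF); last first.
  rewrite (partition_big (fun nu => Ordinal (sN nu)) xpredT) //=.
  apply: eq_bigr => i _; rewrite /phi scaler_sumr.
  by apply: eq_big => [nu|nu /eqP <-].
apply: eq_bigr => nu _.
have -> : P_term_map (idm V) (a *: qid W) (val nu) = a ^+ size_part (val nu) *: \1%VF.
  apply: bpure_ext => v t; rewrite scale_lfunE id_lfunE btensor_map_bpure; first last.
  - exact: tpower_map_equivariant.
  - exact: (gvalP (idm V : ghom _ _)).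
  rewrite id_lfunE.
  have -> : tpower_map (val nu) (a *: qid W) = a ^+ size_part (val nu) *: \1%VF.
    apply: tensor_ext => u; rewrite /tpower_map tensor_mapE scale_lfunE id_lfunE.
    rewrite -prodr_const -pure_scale; congr pure.
    by apply: functional_extensionality_dep => p; rewrite /= scale_lfunE id_lfunE.
  rewrite scale_lfunE id_lfunE.
  have b0 : bpure v (0 : tpower (val nu) W) = 0.
    have := bpure_linearr (-1) v (0 : tpower (val nu) W) 0.
    by rewrite scaler0 addr0 scaleN1r addNr.
  by rewrite -[_ *: t]addr0 bpure_linearr b0 addr0.
apply/lfunP => x; rewrite !comp_lfunE !scale_lfunE linearZ /= id_lfunE.
by rewrite comp_lfunE.
Qed.

End SchurElements.

Arguments ptens : clear implicits.

(** * Free modules *)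

Section FreeRepresentations.
Variables (gT : finGroupType) (J : finType).

Definition freespace : vectType rat := {ffun J * gT -> rat^o}.

Definition free_act_fun (g : gT) (x : freespace) : freespace :=
  [ffun q => x (q.1, g^-1 * q.2)%g].

Fact free_act_linear g : linear (free_act_fun g).
Proof. by move=> a x y; apply/ffunP => q; rewrite !ffunE. Qed.
HB.instance Definition _ g :=
  GRing.isLinear.Build rat freespace freespace _ _ (free_act_linear g).

Program Definition freerep : rep gT :=
  @Rep gT freespace (fun g => linfun (free_act_fun g)) _ _.
Next Obligation.
by apply/lfunP => x; rewrite !lfunE; apply/ffunP => -[j s]; rewrite !ffunE invg1 mul1g.
Qed.
Next Obligation.
apply/lfunP => x; rewrite comp_lfunE !lfunE; apply/ffunP => -[j s].
by rewrite !ffunE invMg mulgA.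
Qed.

Definition free_gen (j : J) : freerep := [ffun q => (q == (j, 1%g))%:R].

Lemma free_act_gen g j : rep_act freerep g (free_gen j) = [ffun q => (q == (j, g))%:R].
Proof.
rewrite lfunE; apply/ffunP => -[j' s]; rewrite !ffunE /= !xpair_eqE.
by rewrite -eq_mulVg1 [g == s]eq_sym.
Qed.

Lemma free_decomp (x : freerep) :
  x = \sum_q x q *: rep_act freerep q.2 (free_gen q.1).
Proof.
apply/ffunP => q; rewrite sum_ffunE (bigD1 q) //= big1 => [|r rq].
  by rewrite !free_act_gen !ffunE -surjective_pairing eqxx addr0 /GRing.scale /= mulr1.
by rewrite free_act_gen !ffunE -surjective_pairing eq_sym (negPf rq) scaler0.
Qed.

Variable V : rep gT.

Definition free_lift_fun (w : J -> V) (x : freespace) : V :=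
  \sum_q x q *: rep_act V q.2 (w q.1).

Fact free_lift_linear w : linear (free_lift_fun w).
Proof.
move=> a x y; rewrite /free_lift_fun scaler_sumr -big_split /=.
by apply: eq_bigr => q _; rewrite !ffunE scalerDl scalerA.
Qed.
HB.instance Definition _ w :=
  GRing.isLinear.Build rat freespace V _ _ (free_lift_linear w).

Definition free_lift (w : J -> V) : 'Hom(freerep, V) := linfun (free_lift_fun w).

Lemma free_lift_act w g j : free_lift w (rep_act freerep g (free_gen j)) = rep_act V g (w j).
Proof.
rewrite free_act_gen lfunE /= /free_lift_fun (bigD1 (j, g)) //= ffunE eqxx scale1r.
by rewrite big1 ?addr0 // => q qj; rewrite ffunE (negPf qj) scale0r.
Qed.

Lemma free_lift_gen w j : free_lift w (free_gen j) = w j.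
Proof.
have := free_lift_act w 1%g j; by rewrite !rep_act1 !id_lfunE.
Qed.

Lemma free_ext_act (f g : 'Hom(freerep, V)) :
  (forall s j, f (rep_act freerep s (free_gen j)) = g (rep_act freerep s (free_gen j))) ->
  f = g.
Proof.
move=> fg; apply/lfunP => x; rewrite (free_decomp x) !linear_sum.
by apply: eq_bigr => q _; rewrite !linearZ /= fg.
Qed.

Lemma free_lift_equivariant w : equivariant (free_lift w).
Proof.
move=> g; apply: free_ext_act => s j; rewrite !comp_lfunE.
rewrite -[rep_act freerep g _]comp_lfunE -rep_actM !free_lift_act rep_actM.
by rewrite comp_lfunE.
Qed.

Lemma free_ext (f g : 'Hom(freerep, V)) : equivariant f -> equivariant g ->
  (forall j, f (free_gen j) = g (free_gen j)) -> f = g.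
Proof.
move=> fE gE fg; apply: free_ext_act => s j.
by rewrite -!comp_lfunE fE gE !comp_lfunE fg.
Qed.

End FreeRepresentations.

Section FreeModules.
Implicit Types W : qob SVect.

Definition free (k : nat -> nat) : qob SVect := fun n => freerep 'S_n 'I_(k n).

Definition fgen k n (j : 'I_(k n)) : free k n := free_gen 'S_n j.

Definition flift k W (w : forall n, 'I_(k n) -> W n) : ghom (free k) W :=
  @GHom _ _ (free k) W (fun n => free_lift (w n))
    (fun n => free_lift_equivariant (w n)).

Lemma flift_gen k W (w : forall n, 'I_(k n) -> W n) n j :
  flift w n (fgen j) = w n j.
Proof. exact: free_lift_gen. Qed.

Lemma fext k W (f g : ghom (free k) W) :
  (forall n (j : 'I_(k n)), f n (fgen j) = g n (fgen j)) -> f = g.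
Proof.
by move=> fg; apply: ghom_eq => n; apply: free_ext (fg n); apply: gvalP.
Qed.

Variable nu : Part.

(** As ['I_(nu n)] is empty for [n] outside the support of [nu], the pairs of
    a degree [n] and an element of ['I_(nu n)] are the slots.  Both [val (tag _)] and
    [tagged _] compute on [slot_of], which avoids transports. *)
Fact slot_subproof n (j : 'I_(nu n)) : n \in finsupp nu.
Proof. by rewrite mem_finsupp -lt0n (leq_ltn_trans _ (ltn_ord j)). Qed.

Definition slot_of n (j : 'I_(nu n)) : slot nu :=
  Tagged (fun i : finsupp nu => 'I_(nu (val i))) (j : 'I_(nu (val [` slot_subproof j]%fset))).

Lemma slot_ofK (p : slot nu) : slot_of (tagged p) = p.
Proof.
case: p => -[n nP] j; rewrite /slot_of /=.
by rewrite (bool_irrelevance (slot_subproof j) nP).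
Qed.

Lemma slot_of_inj n : injective (@slot_of n).
Proof.
move=> j j' jj'.
have : val (tagged (slot_of j)) = val (tagged (slot_of j')) by rewrite jj'.
by move/val_inj.
Qed.

(** [free nu] represents the families of vectors indexed by the slots. *)
Definition slift W (u : forall p : slot nu, slot_family W p) : ghom (free nu) W :=
  flift (fun n (j : 'I_(nu n)) => u (slot_of j) : W n).

Definition sgen (p : slot nu) : slot_family (free nu) p := fgen (tagged p).

Lemma slift_gen W (u : forall p : slot nu, slot_family W p) p :
  slift u (val (tag p)) (sgen p) = u p.
Proof.
rewrite /slift /sgen flift_gen; case: p => -[n nP] j; rewrite /slot_of /=.
by rewrite (bool_irrelevance (slot_subproof j) nP).
Qed.

Lemma sext W (f g : ghom (free nu) W) :
  (forall p, f (val (tag p)) (sgen p) = g (val (tag p)) (sgen p)) -> f = g.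
Proof. by move=> fg; apply: fext => n j; apply: (fg (slot_of j)). Qed.

Lemma slift_sgen : slift sgen = ghom_id (free nu).
Proof. by apply: sext => p; rewrite slift_gen id_lfunE. Qed.

Lemma slift_comp W W' (h : ghom W W') (u : forall p : slot nu, slot_family W p) :
  ghom_comp h (slift u) = slift (fun p => h (val (tag p)) (u p)).
Proof. by apply: sext => p; rewrite comp_lfunE !slift_gen. Qed.

Definition diag (a : slot nu -> rat) : ghom (free nu) (free nu) :=
  slift (fun p => a p *: sgen p).

Lemma slift_diag W a (u : forall p : slot nu, slot_family W p) :
  ghom_comp (slift u) (diag a) = slift (fun p => a p *: u p).
Proof.
rewrite slift_comp; congr slift; apply: functional_extensionality_dep => p.
by rewrite linearZ /= slift_gen.
Qed.

Lemma diag_comp a b : ghom_comp (diag a) (diag b) = diag (fun p => a p * b p).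
Proof.
rewrite slift_diag; congr slift; apply: functional_extensionality_dep => p.
by rewrite scalerA mulrC.
Qed.

Lemma slot_act1 W (u : forall p : slot nu, slot_family W p) : slot_act 1%g u = u.
Proof.
apply: functional_extensionality_dep => -[i j].
by rewrite /slot_act /slot_perm /= ffunE /= ffunE perm1 rep_act1 id_lfunE.
Qed.

Lemma slot_actM W (u : forall p : slot nu, slot_family W p) g h :
  slot_act (g * h)%g u = slot_act g (slot_act h u).
Proof.
apply: functional_extensionality_dep => -[i j].
by rewrite /slot_act /slot_perm /= ffunE /= ffunE permM rep_actM comp_lfunE.
Qed.

Lemma ghom_slot_act W W' (f : ghom W W') (u : forall p : slot nu, slot_family W p) g :
  (fun p => f (val (tag p)) (slot_act g u p)) =
  slot_act g (fun p => f (val (tag p)) (u p) : slot_family W' p).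
Proof.
apply: functional_extensionality_dep => p; rewrite /slot_act.
by rewrite -comp_lfunE gvalP comp_lfunE.
Qed.

(** The wreath product acts on the free module by automorphisms, on the right;
    inverses turn this into a left action. *)
Definition rho (g : Sgrp nu) : ghom (free nu) (free nu) := slift (slot_act g^-1%g sgen).

Lemma slift_rho W (u : forall p : slot nu, slot_family W p) g :
  ghom_comp (slift u) (rho g) = slift (slot_act g^-1%g u).
Proof.
rewrite slift_comp ghom_slot_act; congr (slift (slot_act _ _)).
by apply: functional_extensionality_dep => p; rewrite slift_gen.
Qed.

Lemma rho1 : rho 1%g = ghom_id (free nu).
Proof. by rewrite /rho invg1 slot_act1 slift_sgen. Qed.

Lemma rhoM g h : rho (g * h)%g = ghom_comp (rho g) (rho h).
Proof. by rewrite slift_rho -slot_actM -invMg. Qed.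

Lemma diag_rho a g : ghom_comp (diag a) (rho g) =
  ghom_comp (rho g) (diag (fun p => a (slot_perm g^-1%g p))).
Proof.
rewrite slift_rho slift_diag; congr slift; apply: functional_extensionality_dep => p.
by rewrite /slot_act linearZ.
Qed.

End FreeModules.

(** A subspace of maximal dimension among those contained in [P] contains all
    solutions of [P]. *)
Lemma vspace_of_pred (T : vectType rat) (P : T -> Prop) :
  P 0 -> (forall a x y, P x -> P y -> P (a *: x + y)) ->
  exists U : {vspace T}, forall x, x \in U <-> P x.
Proof.
move=> P0 Plin.
pose Q n := `[< exists U : {vspace T}, \dim U = n /\ forall x, x \in U -> P x >].
have Q0 : exists n, Q n.
  exists 0%N; apply/asboolP; exists 0%VS; rewrite dimv0; split=> // x.
  by rewrite memv0 => /eqP ->.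
have Qmax n : Q n -> (n <= dim T)%N.
  by move/asboolP => [U [<- _]]; rewrite (leq_trans (dimvS (subvf U))) // dimvf.
case: (ex_maxnP Q0 Qmax) => n /asboolP[U [dU UP]] nmax; exists U => x; split=> [/UP //|Px].
have /nmax : Q (\dim (U + <[x]>)).
  apply/asboolP; exists (U + <[x]>)%VS; split=> // y /memv_addP[u uU [_ /vlineP[a ->] ->]].
  by rewrite addrC; apply: Plin => //; apply: UP.
rewrite -dU => dUx; have /eqP -> : U == (U + <[x]>)%VS by rewrite eqEdim addvSl.
by rewrite -[x in x \in _]add0r; apply: memv_add; rewrite ?mem0v ?memv_line.
Qed.

(** * Multilinear parts of a polynomial functor *)

(** The values of a functor and of natural transformations ([fob], [fm] and, further
    on, [pf] and [nc]) are restated at the types of vector spaces and linear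
    maps, to which the linear algebra lemmas apply. *)
Definition fob (F : functor SVect Vect) (W : qob SVect) : vectType rat := F W.

Definition fm (F : functor SVect Vect) (W W' : qob SVect) (f : ghom W W') :
  'Hom(fob F W, fob F W') := @fmap SVect Vect F W W' f.

Section FunctorBasics.
Variable F : functor SVect Vect.

Lemma fm_id W : fm F (ghom_id W) = \1%VF.
Proof. exact: (@fmap_id SVect Vect F W). Qed.

Lemma fm_comp W W' W'' (g : ghom W' W'') (f : ghom W W') :
  fm F (ghom_comp g f) = (fm F g \o fm F f)%VF.
Proof. exact: (@fmap_comp SVect Vect F W W' W'' g f). Qed.

Lemma fm_compE W W' W'' (g : ghom W' W'') (f : ghom W W') x :
  fm F (ghom_comp g f) x = fm F g (fm F f x).
Proof. by rewrite fm_comp comp_lfunE. Qed.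

Lemma fm_polyexp W W' (I : finType) (h : I -> ghom W W') :
  @polynomial_functor SVect Vect F ->
  polyexp (fun a => fm F (\sum_i a i *: h i : ghom W W')).
Proof. by move=> Fpoly; apply: (polynomial_map_exp h (Fpoly W W')). Qed.

(** The vectors of weight (1, ..., 1) for the torus which scales the generators. *)
Definition isML (nu : Part) (x : fob F (free nu)) : Prop :=
  forall a, fm F (diag a) x = (\prod_p a p) *: x.

Lemma isML0 (nu : Part) : isML (0 : fob F (free nu)).
Proof. by move=> a; rewrite linear0 scaler0. Qed.

Lemma isML_linear (nu : Part) a (x y : fob F (free nu)) : isML x -> isML y -> isML (a *: x + y).
Proof.
by move=> xM yM b; rewrite linearP /= xM yM scalerDr !scalerA mulrC.
Qed.

Lemma isML_rho (nu : Part) g (x : fob F (free nu)) : isML x -> isML (fm F (rho g) x).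
Proof.
move=> xM a; rewrite -fm_compE diag_rho fm_compE xM linearZ /=; congr (_ *: _).
rewrite [RHS](reindex_inj (@slot_perm_inj nu g^-1%g)) //.
Qed.

(** With suitable weights this is a projection onto the multilinear vectors;
    as a combination of values of [F] it commutes with natural transformations. *)
Definition mlproj (nu : Part) (K : finType) (w : K -> rat) (pt : K -> slot nu -> rat)
    (x : fob F (free nu)) : fob F (free nu) :=
  \sum_k w k *: fm F (diag (pt k)) x.

Lemma diag_sum (nu : Part) (a : slot nu -> rat) :
  diag a = \sum_p a p *: diag (fun q => (q == p)%:R) :> ghom (free nu) (free nu).
Proof.
have diag_gen b q : diag b (val (tag q)) (sgen q) = b q *: sgen q by apply: slift_gen.
apply: sext => q; rewrite ghom_sumE diag_gen.
under [RHS]eq_bigr do rewrite diag_gen scalerA.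
rewrite -scaler_suml; congr (_ *: _); rewrite (bigD1 q) // eqxx mulr1.
rewrite big1 => [|p]; first by rewrite /= addr0.
by rewrite eq_sym => /negPf ->; rewrite mulr0.
Qed.

(** [F (diag b) o F (diag a) = F (diag (b a))]: comparing the coefficients of the
    product of the variables [a p] on both sides shows that the coefficient of
    this product in [F (diag a)] has multilinear values. *)
Lemma mlproj_ML (nu : Part) : @polynomial_functor SVect Vect F -> exists N0, forall N, (N0 <= N)%N ->
  forall (K : finType) (w : K -> rat) (pt : K -> slot nu -> rat), mlweights N w pt ->
  (forall x, isML (mlproj w pt x)) /\ (forall x, isML x -> mlproj w pt x = x).
Proof.
move=> Fpoly.
have [K' [L [col [e fE]]]] := fm_polyexp (fun p => diag (fun q : slot nu => (q == p)%:R)) Fpoly.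
have [N1 LN] := polyexp_bound L.
exists (maxn #|slot nu|.+1 N1) => N; rewrite geq_max => /andP[sN N1N] K w pt wP.
have {}fE a : fm F (diag a) = \sum_k (\prod_l a (col k l)) *: e k.
  by rewrite diag_sum fE.
have {}LN k : (#|L k| < N)%N by rewrite (leq_trans (LN k)).
split=> [x b|x xM]; last first.
  rewrite /mlproj; under eq_bigr do rewrite xM scalerA; rewrite -scaler_suml.
  by rewrite (wP _ id sN) (_ : bijb _) ?scale1r //; apply/andP; split=> //; apply/injectiveP.
have mlE y : mlproj w pt y = \sum_(k | bijb (col k)) e k y.
  have /(congr1 (fun h : 'End(fob F (free nu)) => h y)) := mlweightsE col e wP LN.
  rewrite !sum_lfunE => <-; apply: eq_bigr => k _.
  by rewrite scale_lfunE fE.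
have -> : fm F (diag b) (mlproj w pt x) =
    \sum_k w k *: \sum_k' (\prod_l pt k (col k' l)) *: ((\prod_l b (col k' l)) *: e k' x).
  rewrite linear_sum; apply: eq_bigr => k _; rewrite linearZ /= -fm_compE diag_comp fE.
  rewrite sum_lfunE; congr (_ *: _); apply: eq_bigr => k' _.
  by rewrite scale_lfunE scalerA -big_split; under eq_bigr do rewrite mulrC.
rewrite (mlweightsE col _ wP LN) mlE scaler_sumr; apply: eq_bigr => k /bijbP[g cg gc].
by congr (_ *: _); rewrite [RHS](reindex (col k)) //; apply: onW_bij; exists g.
Qed.

End FunctorBasics.

Import passmx.

(** * Bounded polynomial functors only see finitely many degrees *)

Section Support.
Variable F : functor SVect Vect.
Hypothesis Fpoly : @polynomial_functor SVect Vect F.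

Program Definition scal (W : qob SVect) (a : nat -> rat) : ghom W W :=
  @GHom _ _ W W (fun n => a n *: \1%VF) _.
Next Obligation.
by move=> g; rewrite -comp_lfunZl -comp_lfunZr comp_lfun1l comp_lfun1r.
Qed.

Lemma scalE W a n (x : (W : gmod _) n) : scal W a n x = a n *: x.
Proof. by rewrite scale_lfunE id_lfunE. Qed.

Lemma scal1 W : scal W (fun=> 1) = ghom_id W.
Proof. by apply: ghom_eq => n; rewrite /= scale1r. Qed.

Lemma scalM W a b : scal W (fun n => a n * b n) = ghom_comp (scal W a) (scal W b).
Proof.
by apply: ghom_eq => n; apply/lfunP => x; rewrite comp_lfunE !scalE scalerA.
Qed.

Variable W : qob SVect.
Local Notation E := (vbasis {: fob F W}).

Definition scal_det (a : nat -> rat) : rat := \det (mxof E E (fm F (scal W a))).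

(** The determinant is taken of a matrix whose entries are polynomial in [c]
    along each polynomial family [beta] of sequences. *)
Lemma scal_det_mult_poly : mult_poly scal_det.
Proof.
have Eb : basis_of {: fob F W} E := vbasisP _.
split.
- by rewrite /scal_det scal1 fm_id mxof1 ?(basis_free Eb) // det1.
- by move=> a b; rewrite /scal_det scalM fm_comp (mxof_comp _ _ Eb) ?det_mulmx 1?mulrC.
move=> beta s bs.
have [K [L [col [e fE]]]] :=
  fm_polyexp (fun i : 'I_s => scal W (fun n => (beta n)`_i)) Fpoly.
pose M : 'M[{poly rat}]_(\dim {: fob F W}) :=
  \sum_k 'X^(\sum_l (col k l : nat)) *: map_mx polyC (mxof E E (e k)).
exists (\det M) => c.
rewrite -[(\det M).[c]]/(horner_eval c (\det M)) -det_map_mx; congr (\det _).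
have -> : scal W (fun n => (beta n).[c]) =
    \sum_(i < s) (c ^+ i) *: scal W (fun n => (beta n)`_i) :> ghom W W.
  apply: ghom_eq => n; apply/lfunP => x; rewrite ghom_sumE scalE (horner_coef_wide c (bs n)).
  rewrite scaler_suml; apply: eq_bigr => i _; by rewrite scalE scalerA mulrC.
rewrite (fE (fun i => c ^+ i)) linear_sum; apply/matrixP => i j.
rewrite /M !mxE !summxE raddf_sum; apply: eq_bigr => k _.
rewrite !mxE scale_lfunE linearZ /= /horner_eval hornerM hornerXn hornerC.
by rewrite expr_sum.
Qed.

(** The idempotent [F e], with [e] the projection to the degrees less than [M], is
    the identity as soon as its determinant is not zero. *)
Lemma fm_support : exists M, fm F (scal W (fun n => (n < M)%N%:R)) = \1%VF.
Proof.
have [M DM] := mult_poly_finite_support scal_det_mult_poly; exists M.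
have Eb : basis_of {: fob F W} E := vbasisP _.
set f := fm F _; pose A := mxof E E f.
have AU : A \in unitmx by rewrite unitmxE unitfE.
apply: (can_inj (mxofK Eb Eb)); rewrite mxof1 ?(basis_free Eb) //.
have : A *m A = A.
  rewrite -(mxof_comp _ _ Eb) -fm_comp -scalM; congr (mxof _ _ (fm _ (scal _ _))).
  by apply: funext => n; case: ltnP; rewrite ?mulr1 ?mulr0.
by move/(congr1 (mulmx (invmx A))); rewrite mulmxA mulVmx // mul1mx.
Qed.

End Support.

Lemma bounded_gmodI (T : choiceType) (gT : T -> finGroupType) (V : gmod gT) (s : {fset T}) :
  (forall t, t \notin s -> forall v : V t, v = 0) -> bounded_gmod V.
Proof.
move=> sP; pose I := {t : s & 'I_(\dim {: V (val t)})}.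
pose b (i : I) : forall t, V t :=
  dfwith (fun t => 0 : V t) ((vbasis {: V (val (tag i))})`_(tagged i)).
exists #|{: I}|, (fun i => b (enum_val i)); split=> [i|x _].
  exists [:: val (tag (enum_val i))] => t; rewrite inE eq_sym => ti.
  by rewrite /b dfwith_out.
pose c (i : I) := coord (vbasis {: V (val (tag i))}) (tagged i) (x (val (tag i))).
exists (fun i => c (enum_val i)) => t.
transitivity (\sum_i c i *: b i t); last first.
  by rewrite (reindex _ (onW_bij _ (@enum_val_bij I))).
rewrite [RHS](_ : _ = \sum_(t' : s) \sum_(j < \dim {: V (val t')})
   c (Tagged _ j) *: b (Tagged _ j) t); last first.
  by rewrite (sig_big_dep _ _ (fun (t' : s) (j : 'I_(\dim {: V (val t')})) => 
    c (Tagged _ j) *: b (Tagged _ j) t)); apply: eq_bigr => -[].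
have [ts|tNs] := boolP (t \in s); last first.
  rewrite (sP t tNs (x t)) big1 // => t' _; rewrite big1 // => j _.
  by rewrite /b dfwith_out ?scaler0 //; apply: contraNneq tNs => <-; apply: valP.
rewrite (bigD1 [` ts]%fset) //= [X in _ + X]big1 ?addr0 => [|t' t't].
  rewrite {1}(coord_vbasis (memvf (x t))); apply: eq_bigr => j _.
  by rewrite /b dfwith_in.
rewrite big1 // => j _; rewrite /b dfwith_out ?scaler0 //.
Qed.

Section BoundedSupport.
Variable F : functor SVect Vect.
Hypothesis Fpoly : @polynomial_functor SVect Vect F.
Hypothesis Fbounded : @bounded_functor SVect F.

Lemma fm_degree : exists d, forall W, exists phi : nat -> 'End(fob F W),
  forall a, fm F (scal W (fun=> a)) = \sum_(i < d.+1) a ^+ i *: phi i.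
Proof.
case: Fbounded => phi [phiE [d phi0]]; exists d => W; exists (phi W) => a.
have [N [phiN fE]] := phiE W.
have {}phi0 i : (d < i)%N -> phi W i = 0.
  move=> /phi0/(_ W)/eqP i0; apply/lfunP => x; rewrite zero_lfunE.
  by apply/eqP; rewrite -memv_ker (subvP _ _ (memvf x)) // lkerE.
rewrite (_ : scal W _ = (a *: qid W : qhom W W)); last by apply: ghom_eq.
rewrite [LHS]fE; pose m := maxn N d.+1.
have widen n : (n <= m)%N -> (forall i, (n <= i)%N -> phi W i = 0) ->
    \sum_(i < n) a ^+ i *: phi W i = \sum_(i < m) a ^+ i *: phi W i.
  move=> nm n0; rewrite (big_ord_widen m (fun i => a ^+ i *: phi W i) nm).
  rewrite [RHS](bigID (fun i : 'I_m => (i < n)%N)) /= [X in _ + X]big1 ?addr0 // => i.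
  by rewrite -leqNgt => /n0 ->; rewrite scaler0.
by rewrite !widen ?leq_maxl ?leq_maxr.
Qed.

Lemma scal_free (nu : Part) a : scal (free nu) a = diag (fun p : slot nu => a (val (tag p))).
Proof. by apply: sext => p; rewrite slift_gen scalE. Qed.

(** Scaling all generators by [t] multiplies a multilinear vector by [t] to the
    number of slots, which cannot exceed the degree of [F]. *)
Lemma isML_degree : exists d, forall (nu : Part) (x : fob F (free nu)),
  (d < #|slot nu|)%N -> isML x -> x = 0.
Proof.
have [d dP] := fm_degree; exists d => nu x; set k := #|slot nu| => dk xM.
have [phi phiE] := dP (free nu).
pose c (i : 'I_k.+1) := if (i < d.+1)%N then - phi i x else if i == k :> nat then x else 0.
suff /(_ ord_max) : forall i, c i = 0 by rewrite /c /= eqxx ltnNge dk.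
apply: poly_coef_eq0 => t; rewrite big_ord_recr /= {2}/c /= eqxx ltnNge dk /=.
have := xM (fun=> t); rewrite -scal_free phiE prodr_const -/k => <-.
rewrite sum_lfunE (big_ord_widen k (fun i => (t ^+ i *: phi i) x) dk).
rewrite [X in _ + X]big_mkcond /= -big_split /= big1 // => i _; rewrite /c /= scale_lfunE.
by case: ifP => _; rewrite ?scalerN ?addNr // ltn_eqF // scaler0 addr0.
Qed.

Lemma scal_comp W W' (f : ghom W W') a :
  ghom_comp (scal W' a) f = ghom_comp f (scal W a).
Proof.
by apply: ghom_eq => n; apply/lfunP => x; rewrite !comp_lfunE scalE scalE linearZ.
Qed.

Lemma slot_card (nu : Part) n : (nu n <= #|slot nu|)%N.
Proof.
by rewrite -{1}[nu n]card_ord; apply: leq_card (@slot_of_inj nu n).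
Qed.

(** The modules [free nu] with at most [d] slots are retracts of a single module, so
    that one bound [M] holds for all of them; and the projection to the degrees less
    than [M] kills the multilinear vectors as soon as it kills a generator. *)
Lemma isML_support : exists M, forall (nu : Part) (x : fob F (free nu)) n,
  (M <= n)%N -> nu n != 0%N -> isML x -> x = 0.
Proof.
have [d dP] := isML_degree.
have [M MP] := fm_support Fpoly (free (fun=> d)).
exists M => nu x n Mn nun xM.
have [/dP/(_ xM) //|sd] := ltnP d #|slot nu|.
have nud m : (nu m <= d)%N by apply: leq_trans sd; apply: slot_card.
pose i : ghom (free nu) (free (fun=> d)) := flift (fun m j => fgen (widen_ord (nud m) j) : free (fun=> d) m).
pose r : ghom (free (fun=> d)) (free nu) :=
  flift (fun m (j : 'I_d) => oapp (@fgen nu m) 0 (insub (val j)) : free nu m).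
have ri : ghom_comp r i = ghom_id (free nu).
  apply: fext => m j; rewrite comp_lfunE flift_gen flift_gen /= id_lfunE.
  by rewrite valK.
have : fm F (scal (free nu) (fun m => (m < M)%N%:R)) x = x.
  rewrite -[x in RHS]id_lfunE -fm_id -ri fm_compE.
  rewrite -[in RHS](id_lfunE (fm F i x)) -MP -!fm_compE.
  rewrite -scal_comp; congr (fm F _ x); apply: ghom_eq => m; apply/lfunP => y.
  rewrite !comp_lfunE; congr (_ _).
  by have := congr1 (fun h : ghom (free nu) (free nu) => h m y) ri; rewrite comp_lfunE id_lfunE.
rewrite scal_free xM.
have j : 'I_(nu n) by exists 0%N; rewrite lt0n.
by rewrite (bigD1 (slot_of j)) //= ltnNge Mn mul0r scale0r.
Qed.

Lemma isML_bounded : exists s : {fset Part}, forall (nu : Part) (x : fob F (free nu)),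
  nu \notin s -> isML x -> x = 0.
Proof.
have [d dP] := isML_degree; have [M MP] := isML_support.
pose mk (f : {ffun 'I_M -> 'I_d.+1}) : Part :=
  [fsfun n in [fset val i | i in 'I_M]%fset => oapp (fun i => val (f i)) 0%N (insub n)].
exists [fset mk f | f in {: {ffun 'I_M -> 'I_d.+1}}]%fset => nu x nus xM.
have [/dP/(_ xM) //|sd] := ltnP d #|slot nu|.
have [[n /andP[Mn nun]]|nuM] := pselect (exists n, (M <= n)%N && (nu n != 0%N)).
  exact: MP Mn nun xM.
case/negP: nus; apply/imfsetP => /=.
have nud (i : 'I_M) : (nu i < d.+1)%N by rewrite ltnS (leq_trans (slot_card _ _)).
exists [ffun i => Ordinal (nud i)] => //; apply/fsfunP => n; rewrite fsfunE.
have [nM|Mn] := ltnP n M.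
  rewrite (_ : n \in _); last by apply/imfsetP; exists (Ordinal nM).
  by rewrite insubT /= ffunE.
case: ifP => [/imfsetP[/= i _ ni]|_]; first by move: Mn; rewrite ni leqNgt ltn_ord.
by apply/eqP/negP => /negP nun; apply: nuM; exists n; rewrite Mn.
Qed.

End BoundedSupport.

(** * Representations on multilinear vectors, and evaluation *)

(** Setting a variable to 1 turns statements on linear combinations into statements
    on affine ones. *)
Lemma polyexp_subst1 (I : finType) (E : lmodType rat) (f : (I + unit -> rat) -> E) :
  polyexp f -> polyexp (fun b => f (fun o => if o is inl i then b i else 1)).
Proof.
case=> K [L [col [e fE]]].
have [K' [L' [col' [e' H]]]] :=
  @polyexp_mon I E K (fun k i => #|[pred l | col k l == inl i]|) e.
exists K', L', col', e' => b; rewrite -H fE; apply: eq_bigr => k _; congr (_ *: _).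
rewrite (prod_word (col k) (fun o => if o is inl i then b i else 1)) big_sumType /= [X in _ * X]big1 ?mulr1 // => u _.
by rewrite expr1n.
Qed.

Lemma polyexp_eval (I : finType) (T T' : vectType rat) (f : (I -> rat) -> 'Hom(T, T')) x :
  polyexp f -> polyexp (fun a => f a x).
Proof.
case=> K [L [col [e fE]]]; exists K, L, col, (fun k => e k x) => a.
by rewrite fE sum_lfunE; apply: eq_bigr => k _; rewrite scale_lfunE.
Qed.

Section SubRestriction.
Variables (T T' : vectType rat) (U : {vspace T}) (U' : {vspace T'}).

Definition subrestr (f : 'Hom(T, T')) : 'Hom(subvs_of U, subvs_of U') :=
  (linfun (vsproj U') \o f \o linfun vsval)%VF.

Lemma subrestrE (f : 'Hom(T, T')) (x : subvs_of U) :
  f (vsval x) \in U' -> vsval (subrestr f x) = f (vsval x).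
Proof. by move=> fx; rewrite !comp_lfunE !lfunE /= vsprojK. Qed.

End SubRestriction.

Section MultilinearParts.
Variable F : functor SVect Vect.

Definition MLs (nu : Part) : {vspace fob F (free nu)} :=
  projT1 (cid (vspace_of_pred (@isML0 F nu) (@isML_linear F nu))).

Lemma memMLs (nu : Part) (x : fob F (free nu)) : x \in MLs nu <-> isML x.
Proof. exact: projT2 (cid (vspace_of_pred (@isML0 F nu) (@isML_linear F nu))) x. Qed.

Lemma vsval_ML (nu : Part) (x : subvs_of (MLs nu)) : isML (vsval x).
Proof. by apply/memMLs; apply: subvsP. Qed.

Definition ML_act nu (g : Sgrp nu) : 'End(subvs_of (MLs nu)) :=
  subrestr _ _ (fm F (rho g)).

Lemma ML_actE (nu : Part) g (x : subvs_of (MLs nu)) :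
  vsval (ML_act g x) = fm F (rho g) (vsval x).
Proof. by rewrite subrestrE //; apply/memMLs/isML_rho/vsval_ML. Qed.

Program Definition ML_rep (nu : Part) : rep (Sgrp nu) :=
  @Rep (Sgrp nu) (subvs_of (MLs nu)) (@ML_act nu) _ _.
Next Obligation.
by apply/lfunP => x; apply/val_inj; rewrite [LHS]ML_actE rho1 fm_id !id_lfunE.
Qed.
Next Obligation.
apply/lfunP => x; apply/val_inj; rewrite [LHS]ML_actE comp_lfunE [RHS]ML_actE.
by rewrite ML_actE rhoM fm_compE.
Qed.

Definition ML_gmod : gmod Sgrp := ML_rep.

Lemma ML_gmod_bounded : bounded_polynomial (F : functor_cat SVect Vect) ->
  bounded_gmod ML_gmod.
Proof.
case=> Fpoly Fbounded; have [s sP] := isML_bounded Fpoly Fbounded.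
apply: (@bounded_gmodI Part Sgrp ML_gmod s) => nu nus x; apply/val_inj.
by apply: (sP nu (vsval x) nus); apply: vsval_ML.
Qed.

Hypothesis Fpoly : @polynomial_functor SVect Vect F.

(** As a function of one of the vectors the map is polynomial, and it is
    homogeneous of degree one because scaling this vector amounts to scaling a
    generator. *)
Lemma fm_slift_multilinear (nu : Part) (W : qob SVect) (x : fob F (free nu)) : isML x ->
  multilinear (fun u : forall p : slot nu, slot_family W p => fm F (slift u) x).
Proof.
move=> xM i a u v w uvw wi.
pose s (b : bool -> rat) := dfwith w (b true *: u i + b false *: v i).
pose f b := fm F (slift (s b)) x.
have fpoly : polyexp f.
  pose h (o : bool + unit) : ghom (free nu) W :=
    if o is inl b then slift (dfwith (fun p => 0 : slot_family W p) (if b then u i else v i))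
    else slift (dfwith w (0 : slot_family W i)).
  have := polyexp_subst1 (polyexp_eval x (fm_polyexp h Fpoly)).
  case=> K [L [col [e H]]]; exists K, L, col, e => b; rewrite -H; congr (fm F _ x).
  apply: sext => p; rewrite ghom_sumE big_sumType big_bool /=.
  rewrite (big_pred1 tt) ?scale1r; last by case.
  rewrite !slift_gen /s; have [<-|ip] := eqVneq i p; first by rewrite !dfwith_in addr0.
  by rewrite !dfwith_out // !scaler0 !add0r.
have fhom t b : f (fun i => t * b i) = t *: f b.
  rewrite /f; have -> : slift (s (fun i => t * b i)) =
      ghom_comp (slift (s b)) (diag (fun p => if p == i then t else 1)).
    rewrite slift_diag; congr slift; apply: functional_extensionality_dep => p.
    rewrite /s; have [->|pi] := eqVneq p i; first by rewrite !dfwith_in scalerDr !scalerA.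
    by rewrite !dfwith_out 1?eq_sym // scale1r.
  rewrite fm_compE xM linearZ /=; congr (_ *: _).
  by rewrite (bigD1 i) //= eqxx big1 ?mulr1 // => p /negPf ->.
have sE b z : (forall j, j != i -> z j = w j) -> z i = b true *: u i + b false *: v i ->
    fm F (slift z) x = f b.
  move=> zw zi; congr (fm F (slift _) x); apply: functional_extensionality_dep => p.
  by rewrite /s; have [->|pi] := eqVneq p i; rewrite ?dfwith_in // dfwith_out 1?eq_sym // zw.
rewrite (sE (fun b => if b then a else 1) w) ?scale1r //.
rewrite (sE (fun b => (b == true)%:R) u) ?scale1r ?scale0r ?addr0 //; last by move=> j /uvw[].
rewrite (sE (fun b => (b == false)%:R) v) ?scale1r ?scale0r ?add0r //; last by move=> j /uvw[].
by rewrite (polyexp_homog1 fpoly fhom) big_bool scale1r.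
Qed.

Section Evaluation.
Variable W : qob SVect.

Definition theta_form (nu : Part) (x : ML_rep nu) : 'Hom(tpower nu W, fob F W) :=
  tensor_lift (fun u : forall p : slot nu, slot_family W p => fm F (slift u) (vsval x)).

Lemma theta_formE (nu : Part) (x : ML_rep nu) (u : forall p : slot nu, slot_family W p) :
  theta_form x (pure u) = fm F (slift u) (vsval x).
Proof. by apply: tensor_liftE; apply: fm_slift_multilinear; apply: vsval_ML. Qed.

(** The action on [free nu] was defined so that [slift (g u) o rho g = slift u]. *)
Lemma theta_form_act (nu : Part) g (x : ML_rep nu) t :
  theta_form (rep_act _ g x) (rep_act (tpower nu W) g t) = theta_form x t.
Proof.
rewrite -comp_lfunE; congr (fun_of_lfun _ t); apply: tensor_ext => u.
rewrite comp_lfunE [rep_act (tpower nu W) g _]tpower_actE !theta_formE ML_actE -fm_compE.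
by rewrite slift_rho -slot_actM mulVg slot_act1.
Qed.

Lemma theta_form_linearl (nu : Part) t : linear (fun x : ML_rep nu => theta_form x t).
Proof.
move=> a x y; rewrite !lfunE /= /tensor_lift_fun scaler_sumr -big_split /=.
apply: eq_bigr => k _; rewrite linearP /= scalerDr; congr (_ + _).
by rewrite !scalerA mulrC.
Qed.

End Evaluation.
End MultilinearParts.

(** * The functor of multilinear parts and its counit *)

Definition polyfun : Type := polynomial_functors SVect.

Definition pf (F : polyfun) : functor SVect Vect :=
  fs_ob (F : fullsub_ob (@bounded_polynomial SVect)).

Lemma pf_poly (F : polyfun) : @polynomial_functor SVect Vect (pf F).
Proof. by case: F => F []. Qed.

Definition ML_ob (F : polyfun) : S2Vect_bounded :=
  @FullSubOb S2Vect (fun V => bounded_gmod (V : gmod Sgrp)) (ML_gmod (pf F))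
    (ML_gmod_bounded (fs_prop (F : fullsub_ob (@bounded_polynomial SVect)))).

Section NaturalMaps.
Variables (F G : functor SVect Vect) (s : natural F G).

Definition nc (W : qob SVect) : 'Hom(fob F W, fob G W) := s W.

Lemma nc_nat W W' (f : ghom W W') x : nc W' (fm F f x) = fm G f (nc W x).
Proof.
have := congr1 (fun h : 'Hom(fob F W, fob G W') => h x) (naturality s (f : qhom (q := SVect) W W')).
by rewrite /= !comp_lfunE.
Qed.

Lemma isML_nc (nu : Part) x : isML x -> isML (nc (free nu) x).
Proof. by move=> xM a; rewrite -nc_nat xM linearZ. Qed.

Definition ML_map_fun (nu : Part) : 'Hom(ML_rep F nu, ML_rep G nu) :=
  subrestr (MLs F nu) (MLs G nu) (nc (free nu)).

Lemma ML_map_funE (nu : Part) (x : ML_rep F nu) :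
  vsval (ML_map_fun nu x) = nc (free nu) (vsval x).
Proof. by apply: subrestrE; apply/memMLs/isML_nc/vsval_ML. Qed.

Fact ML_map_equivariant (nu : Part) : equivariant (ML_map_fun nu).
Proof.
move=> g; apply/lfunP => x; apply/val_inj.
rewrite (comp_lfunE (ML_map_fun nu)) (comp_lfunE (rep_act (ML_rep G nu) g)).
rewrite [LHS]ML_map_funE [RHS](ML_actE g (ML_map_fun nu x)) ML_map_funE -nc_nat.
by congr (_ _); apply: (ML_actE g x).
Qed.

Definition ML_map : ghom (ML_gmod F) (ML_gmod G) :=
  @GHom _ _ (ML_gmod F) (ML_gmod G) ML_map_fun ML_map_equivariant.

End NaturalMaps.

Program Definition ML_functor : functor (polynomial_functors SVect) S2Vect_bounded :=
  @Functor (polynomial_functors SVect) S2Vect_bounded ML_ob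
    (fun F G s => ML_map (s : natural (pf F) (pf G))) _ _.
Next Obligation.
apply: ghom_eq => nu; apply/lfunP => x; apply/val_inj.
by rewrite [LHS]ML_map_funE /nc /= !id_lfunE.
Qed.
Next Obligation.
apply: ghom_eq => nu; apply/lfunP => x; apply/val_inj.
have e := etrans (ML_map_funE g (ML_map_fun f nu x))
  (congr1 (nc g (free nu)) (ML_map_funE f x)).
transitivity (nc g (free nu) (nc f (free nu) (vsval x))).
  by rewrite [LHS]ML_map_funE /nc [LHS]comp_lfunE.
by rewrite -e [in RHS]comp_lfunE.
Qed.

Section Theta.
Variable F : polyfun.

(** Evaluation of [x] along the maps [free nu -> W]. *)
Definition theta (W : qob SVect) : 'Hom(P_space (ML_ob F) W, fob (pf F) W) :=
  P_lift (V := ML_ob F) (W := W)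
    (fun nu => bpure_lift (fun (x : ML_rep (pf F) nu) (t : tpower nu W) => theta_form W x t)).

Lemma theta_ptens W (nu : Part) (x : ML_rep (pf F) nu) (u : forall p : slot nu, slot_family W p) :
  theta W (ptens (ML_ob F) W nu x (pure u)) = fm (pf F) (slift u) (vsval x).
Proof.
rewrite /theta P_liftE bpure_liftE.
- exact: (theta_formE (pf_poly F)).
- by move=> t; apply: theta_form_linearl.
- by move=> y a t t'; rewrite linearP.
- by move=> g y t; apply: (theta_form_act (pf_poly F)).
Qed.

Lemma theta_natural W W' (h : ghom W W') z :
  theta W' (P_map (idm (ML_ob F)) (h : qhom (q := SVect) W W') z) = fm (pf F) h (theta W z).
Proof.
apply: (P_ext_fun (f := fun z => theta W' (P_map _ _ z)) (g := fun z => fm _ h (theta W z))).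
- by move=> a x y; rewrite linearP; apply: linearP.
- by move=> a x y; rewrite linearP; apply: linearP.
move=> nu x u; rewrite (P_mapE_pure (idm (ML_ob F)) (h : qhom (q := SVect) W W') x u) !theta_ptens.
rewrite -fm_compE slift_comp; congr (fm _ _ (vsval _)); exact: id_lfunE.
Qed.

End Theta.

Lemma theta_ML_map (F G : polyfun) (s : natural (pf F) (pf G)) W z :
  theta G W (P_map (ML_map s : hom (ML_ob F) (ML_ob G)) (qid W) z) = nc s W (theta F W z).
Proof.
apply: (P_ext_fun (f := fun z => theta G W (P_map _ _ z)) (g := fun z => nc s W (theta F W z))).
- by move=> a x y; rewrite linearP; apply: linearP.
- by move=> a x y; rewrite linearP; apply: linearP.
move=> nu x u; rewrite (P_mapE_pure (ML_map s : hom (ML_ob F) (ML_ob G)) (qid W) x u) !theta_ptens.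
rewrite nc_nat; congr (fm _ (slift _) _).
  by apply: functional_extensionality_dep => p; rewrite id_lfunE.
exact: ML_map_funE.
Qed.

(** * The multilinear parts of a Schur functor *)

Section MultilinearExtension.
Variables (I : finType) (U : I -> vectType rat) (T : vectType rat).
Variable B : forall i, U i -> Prop.
Hypothesis Bspan : forall i (x : U i), exists (K : finType) (c : K -> rat) (b : K -> U i),
  (forall k, B (b k)) /\ x = \sum_k c k *: b k.

Lemma multilinear_eq0 (M : (forall i, U i) -> T) : multilinear M ->
  (forall u, (forall i, B (u i)) -> M u = 0) -> forall u, M u = 0.
Proof.
move=> Mm MB; suff H (s : seq I) u : (forall i, i \notin s -> B (u i)) -> M u = 0.
  by move=> u; apply: (H (enum I)) => i; rewrite mem_enum.
elim: s u => [|i s IHs] u uB; first by apply: MB => i; apply: uB.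
have [K [c [b [bB ui]]]] := Bspan (u i).
have Mlin a x y : M (dfwith u (a *: x + y : U i)) = a *: M (dfwith u x) + M (dfwith u y).
  by apply: (Mm i); rewrite ?dfwith_in // => j ji; rewrite !dfwith_out 1?eq_sym.
have M0 : M (dfwith u (0 : U i)) = 0.
  by have := Mlin (-1) 0 0; rewrite scaler0 addr0 scaleN1r addNr.
have -> : M u = M (dfwith u (u i)).
  by congr M; apply: functional_extensionality_dep => j; case: dfwithP.
rewrite ui; elim/big_rec: _ => [//|k x _ IH]; rewrite Mlin IH addr0.
rewrite IHs ?scaler0 // => j js; have [->|ji] := eqVneq j i; first by rewrite dfwith_in.
by rewrite dfwith_out 1?eq_sym //; apply: uB; rewrite inE negb_or ji.
Qed.

End MultilinearExtension.

Lemma slot_fiber (nu : Part) n : #|[set p : slot nu | val (tag p) == n]| = nu n.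
Proof.
rewrite -[RHS]card_ord -cardsT -(card_imset _ (@slot_of_inj nu n)).
apply: eq_card => p; rewrite inE; apply/eqP/imsetP => [pn|[j _ ->] //].
by subst n; exists (tagged p); rewrite ?slot_ofK.
Qed.

Lemma slot_bij_eq (mu nu : Part) (f : slot mu -> slot nu) : bijb f ->
  (forall p, val (tag (f p)) = val (tag p)) -> mu = nu.
Proof.
case/bijbP => g fg gf fdeg; apply/fsfunP => n.
rewrite -(slot_fiber mu) -(slot_fiber nu) -(card_imset _ (can_inj fg)).
apply: eq_card => q; rewrite [RHS]inE; apply/imsetP/eqP => [[p + ->]|qn].
  by rewrite inE fdeg => /eqP.
by exists (g q); rewrite ?gf // inE -fdeg gf qn.
Qed.

Section Eta.
Variable V : S2Vect_bounded.
Local Notation PV := (P_functor V).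

Definition eta_fun (nu : Part) (v : part V nu) : fob PV (free nu) :=
  ptens V (free nu) nu v (pure (@sgen nu)).

Fact eta_linear (nu : Part) : linear (@eta_fun nu).
Proof. by move=> a v v'; apply: ptens_linearl. Qed.
HB.instance Definition _ (nu : Part) :=
  GRing.isLinear.Build rat (part V nu) (fob PV (free nu)) _ _ (@eta_linear nu).

Lemma fmP_pure W W' (h : ghom W W') (nu : Part) v (u : forall p : slot nu, slot_family W p) :
  fm PV h (ptens V W nu v (pure u)) =
  ptens V W' nu v (pure (fun p => h (val (tag p)) (u p))).
Proof.
rewrite [LHS](P_mapE_pure (idm V) (h : qhom (q := SVect) W W') v u).
by congr (ptens V W' nu _ _); apply: id_lfunE.
Qed.

Lemma eta_ML (nu : Part) v : isML (@eta_fun nu v).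
Proof.
move=> a; rewrite /eta_fun fmP_pure -ptensZr -pure_scale; congr (ptens _ _ _ _ (pure _)).
by apply: functional_extensionality_dep => p; apply: slift_gen.
Qed.

Lemma eta_act (nu : Part) g v : eta_fun (rep_act (part V nu) g v) = fm PV (rho g) (eta_fun v).
Proof.
rewrite /eta_fun fmP_pure -(ptens_act g^-1%g) -[rep_act (part V nu) _ _]comp_lfunE -rep_actM.
rewrite mulVg rep_act1 id_lfunE [rep_act (tpower _ _) _ _]tpower_actE.
congr (ptens _ _ _ _ (pure _)).
by apply: functional_extensionality_dep => p; rewrite slift_gen.
Qed.

(** [leading (pure u)] is the coefficient of the tensor of the generators. *)
Definition leading (nu : Part) : 'Hom(tpower nu (free nu), rat^o) :=
  tensor_lift (fun u : forall p : slot nu, slot_family (free nu) p =>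
    \prod_p (u p : freespace _ _) (tagged p, 1%g) : rat^o).

Lemma leading_pure (nu : Part) (u : forall p : slot nu, slot_family (free nu) p) :
  leading nu (pure u) = \prod_p (u p : freespace _ _) (tagged p, 1%g).
Proof.
apply: tensor_liftE => p a u1 u2 w uw wp.
rewrite (bigD1 p) //= [in RHS](bigD1 p) //= [X in _ = _ + X](bigD1 p) //=.
rewrite wp !ffunE mulrDl /GRing.scale /= -mulrA.
by congr (_ * (_ * _) + _ * _); apply: eq_bigr => q /uw[e1 e2]; rewrite ?e1 ?e2.
Qed.

Lemma leading_act (nu : Part) (g : Sgrp nu) :
  leading nu (rep_act (tpower nu (free nu)) g (pure (@sgen nu))) = (g == 1%g)%:R.
Proof.
rewrite [rep_act _ _ _]tpower_actE leading_pure.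
under eq_bigr => p _ do rewrite /slot_act free_act_gen ffunE xpair_eqE /=.
have [->|g1] := eqVneq g 1%g.
  by rewrite big1 // => -[i j] _ /=; rewrite !ffunE /= perm1 !eqxx.
have [p /negPf pN] : exists p : slot nu,
    ~~ ((tagged p == wr_top (g (tag p)) (tagged p)) && (1%g == wr_base (g (tag p)) (tagged p))).
  apply/existsP; rewrite -negb_forall; apply: contra g1 => /forallP gP.
  apply/eqP/ffunP => i; rewrite !ffunE; case gi : (g i) => [b s]; congr Wreath.
    apply/ffunP => j; have /andP[_ /eqP] := gP (Tagged (fun i : finsupp nu => 'I_(nu (val i))) j).
    by rewrite /= gi !ffunE => <-.
  by apply/permP => j; have /andP[/eqP] := gP (Tagged (fun i : finsupp nu => 'I_(nu (val i))) j); rewrite /= gi perm1 => <-.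
by rewrite (bigD1 p) //= pN mul0r.
Qed.

(** Summing over the group makes [v (x) t |-> leading t v] invariant, and at the
    tensor of the generators the only nonzero term is the one of [g = 1]. *)
Definition averaging (nu : Part) (v : part V nu) (t : tpower nu (free nu)) : part V nu :=
  \sum_g leading nu (rep_act (tpower nu (free nu)) g t) *: rep_act (part V nu) g v.

Lemma eta_inj (nu : Part) : injective (@eta_fun nu).
Proof.
move=> v v' vv'.
have [nuV|nuV] := boolP (nu \in support V); last by rewrite (part0 v nuV) (part0 v' nuV).
have {vv'} : bpure v (pure (@sgen nu) : tpower nu (free nu)) = bpure v' (pure (@sgen nu) : tpower nu (free nu)).
  have /(congr1 (psum_proj (support V) (P_term V (free nu)) nu)) := vv'.
  have pK x : psum_proj (support V) (P_term V (free nu)) nu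
      (psum_inj (support V) (P_term V (free nu)) nu x) = x.
    by have /lfunP/(_ x) := psum_injK (P_term V (free nu)) nuV; rewrite comp_lfunE id_lfunE.
  by rewrite !pK.
have avE w : bpure_lift (@averaging nu) (bpure w (pure (@sgen nu) : tpower nu (free nu))) = w.
  rewrite bpure_liftE.
  - rewrite /averaging (bigD1 1%g) //= leading_act eqxx rep_act1 id_lfunE scale1r.
    by rewrite big1 ?addr0 // => g /negPf g1; rewrite leading_act g1 scale0r.
  - move=> t a x y; rewrite /averaging scaler_sumr -big_split /=; apply: eq_bigr => g _.
    by rewrite linearP scalerDr !scalerA mulrC.
  - move=> x a t t'; rewrite /averaging scaler_sumr -big_split /=; apply: eq_bigr => g _.
    by rewrite !linearP scalerDl scalerA.
  - move=> h x t; rewrite /averaging [RHS](reindex_inj (mulIg h)) /=; apply: eq_bigr => g _.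
    have actM (R : rep (Sgrp nu)) (y : R) : rep_act R (g * h)%g y = rep_act R g (rep_act R h y).
      by rewrite rep_actM comp_lfunE.
    by rewrite -actM; congr (leading nu _ *: _); apply/esym/(actM (tpower nu (free nu))).
by move/(congr1 (bpure_lift (@averaging nu))); rewrite !avE.
Qed.

End Eta.

Section EtaSurjective.
Variable V : S2Vect_bounded.
Local Notation PV := (P_functor V).

Lemma free_span (k : nat -> nat) n (x : free k n) :
  exists (K : finType) (c : K -> rat) (b : K -> free k n),
  (forall i, exists j s, b i = rep_act (freerep 'S_n 'I_(k n)) s (free_gen _ j)) /\
  x = \sum_i c i *: b i.
Proof.
exists ('I_(k n) * 'S_n)%type, (fun q => (x : freespace _ _) q),
  (fun q => rep_act (freerep 'S_n 'I_(k n)) q.2 (free_gen _ q.1)).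
by split=> [q|]; [exists q.1, q.2 | apply: free_decomp].
Qed.

(** A tensor of translated generators is multihomogeneous; if it has degree one
    in each generator, then its letters are the generators in some order, so that
    it is a translate of the tensor of the generators. *)
Lemma eta_surj_gen (mu nu : Part) (v : part V mu)
    (j : forall p : slot mu, 'I_(nu (val (tag p)))) (s : forall p : slot mu, 'S_(val (tag p))) :
  bijb (fun p => slot_of (j p)) ->
  exists w : part V nu,
    ptens V (free nu) mu v (pure (fun p : slot mu =>
      rep_act (freerep 'S_(val (tag p)) 'I_(nu (val (tag p)))) (s p) (free_gen _ (j p)))) =
    eta_fun w.
Proof.
move=> jb; have mn : mu = nu by apply: slot_bij_eq jb _ => p.
subst mu.
have jinj (i : finsupp nu) : injective
    (fun k : 'I_(nu (val i)) => j (Tagged (fun i : finsupp nu => 'I_(nu (val i))) k) : 'I_(nu (val i))).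
  move=> k k' kk'; case/bijbP: jb => g jg _.
  set T := (fun i : finsupp nu => 'I_(nu (val i))).
  have e : Tagged T k = Tagged T k'.
    by apply: (can_inj jg); rewrite kk'.
  by have := congr1 (fun p => tagged_as (Tagged T k) p) e; rewrite !tagged_asE.
pose g : Sgrp nu := [ffun i : finsupp nu => 
  Wreath [ffun k : 'I_(nu (val i)) => s (Tagged (fun i : finsupp nu => 'I_(nu (val i))) k) : 'S_(val i)] (perm (@jinj i))].
exists (rep_act (part V nu) g^-1%g v).
rewrite /eta_fun -[RHS](ptens_act g) -[rep_act (part V nu) _ _]comp_lfunE -rep_actM.
rewrite mulgV rep_act1 id_lfunE; congr (ptens _ _ _ _ _).
apply/esym; apply: etrans (tpower_actE _ _) _; congr pure.
apply: functional_extensionality_dep => -[i k].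
by rewrite /slot_act /slot_perm /sgen /= ffunE /= ffunE permE.
Qed.

(** A multilinear vector is fixed by the projection [mlproj], which maps a tensor of
    translated generators to itself or to 0 according to whether each generator
    occurs exactly once. *)
Lemma eta_surj (nu : Part) (x : fob PV (free nu)) : isML x -> exists v, x = @eta_fun V nu v.
Proof.
move=> xM; have Ppoly := @P_polynomial V.
have [N0 N0P] := mlproj_ML nu Ppoly.
have [N1 N1P] := polyexp_bound (fun mu : support V => slot (val mu)).
pose N := maxn 2 (maxn N0 N1).
have [|K [w [pt wP]]] := @mlweights_exists (slot nu) N; first by rewrite leq_max.
have N0N : (N0 <= N)%N by rewrite !leq_max leqnn orbT.
have [_ projid] := N0P N N0N K w pt wP.
have {projid} -> : x = mlproj w pt x by rewrite projid.
pose im : {vspace fob PV (free nu)} := limg (linfun (@eta_fun V nu)).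
pose f (y : P_space V (free nu)) : quot im := quot_pi im (mlproj w pt (y : fob PV (free nu))).
suff /(_ x)/eqP : f =1 (fun=> 0).
  rewrite /f -memv_ker quot_ker => /memv_imgP[v _ ->].
  by exists v; rewrite lfunE.
have mlprojE y : mlproj w pt y = (\sum_k w k *: fm PV (diag (pt k))) y.
  by rewrite sum_lfunE; apply: eq_bigr => k _; rewrite scale_lfunE.
have flin : linear f by move=> a y z; rewrite /f !mlprojE !linearP.
apply: P_ext_fun => //.
- by move=> a y z; rewrite scaler0 addr0.
move=> mu v; have [muV|muV] := boolP (mu \in support V); last first.
  by move=> u; rewrite /f ptens_notin // mlprojE !linear0.
apply: (multilinear_eq0 (B := fun (p : slot mu) (y : slot_family (free nu) p) =>
   exists j s, y = rep_act (freerep 'S_(val (tag p)) 'I_(nu (val (tag p)))) s (free_gen _ j))).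
- by move=> p y; apply: free_span.
- move=> p a u1 u2 u uu up.
  by rewrite (pure_multilinear uu up) ptens_linearr; apply: flin.
move=> u uB.
pose j p := projT1 (cid (uB p)); pose s p := projT1 (cid (projT2 (cid (uB p)))).
have -> : u = fun p => rep_act (freerep 'S_(val (tag p)) 'I_(nu (val (tag p)))) (s p) (free_gen _ (j p)).
  apply: functional_extensionality_dep => p; exact: projT2 (cid (projT2 (cid (uB p)))).
rewrite /f; set y := ptens _ _ _ _ _.
have diagy a : fm PV (diag a) y = (\prod_p a (slot_of (j p))) *: y.
  rewrite [LHS]fmP_pure -ptensZr -pure_scale; congr (ptens _ _ _ _ (pure _)).
  apply: functional_extensionality_dep => p; rewrite -linearZ /=.
  have /lfunP/(_ (fgen (j p))) := @gvalP _ _ _ _ (diag a) (val (tag p)) (s p).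
  rewrite !comp_lfunE => e; apply: etrans e _; congr (_ _).
  exact: (slift_gen _ (slot_of (j p))).
have -> : mlproj (F := PV) w pt y = (bijb (fun p => slot_of (j p)))%:R *: y.
  rewrite /mlproj; under eq_bigr do rewrite diagy scalerA.
  rewrite -scaler_suml wP // !leq_max.
  by have := N1P [` muV]%fset; rewrite /= => ->; rewrite !orbT.
have [jb|_] := boolP (bijb _); last by rewrite scale0r linear0.
have [v'] := eta_surj_gen v s jb; rewrite -/y => ->.
apply/eqP; rewrite scale1r -memv_ker quot_ker; apply/memv_imgP; exists v'; rewrite ?memvf //.
by rewrite lfunE.
Qed.

End EtaSurjective.

(** * Polynomial functors are generated by their multilinear parts *)

Lemma fiber_inj (A B : finType) (T : eqType) (f : A -> T) (g : B -> T) :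
  (forall t, #|[set a | f a == t]| = #|[set b | g b == t]|) ->
  exists2 h : A -> B, injective h & forall a, g (h a) = f a.
Proof.
move=> fg; have fP a : a \in [set a' | f a' == f a] by rewrite inE.
pose h t a (aP : a \in [set a' | f a' == t]) :=
  enum_val (cast_ord (fg t) (enum_rank_in aP a)).
have gh t a aP : g (@h t a aP) = t.
  by have := enum_valP (cast_ord (fg t) (enum_rank_in aP a)); rewrite inE => /eqP.
exists (fun a => h (f a) a (fP a)) => [a a' hh|a]; last exact: gh.
have e : f a' = f a by rewrite -(gh _ _ (fP a')) -hh gh.
move: (fP a') hh; rewrite {1 2}e => aP' /enum_val_inj/cast_ord_inj.
by apply: enum_rank_in_inj; rewrite ?fP.
Qed.

Lemma fiber_bij (A B : finType) (T : eqType) (f : A -> T) (g : B -> T) :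
  (forall t, #|[set a | f a == t]| = #|[set b | g b == t]|) ->
  exists2 h : A -> B, bijective h & forall a, g (h a) = f a.
Proof.
move=> fg; have [h hi gh] := fiber_inj fg; exists h => //.
have [h' hi' _] := fiber_inj (fun t => esym (fg t)).
by apply: inj_card_bij hi _; apply: leq_card hi'.
Qed.

(** Any finite set graded by degrees is the set of slots of some [nu]. *)
Lemma sort_slots (J : finType) (d : J -> nat) :
  exists (nu : Part) (b : slot nu -> J), bijective b /\ forall p, d (b p) = val (tag p).
Proof.
pose nu : Part := [fsfun m in [fset d j | j in {: J}]%fset => #|[set j | d j == m]|].
have nuE m : nu m = #|[set j | d j == m]|.
  rewrite fsfunE; case: ifP => // /negbT md; apply/esym/eqP; rewrite cards_eq0.
  apply: contraNT md => /set0Pn[j]; rewrite inE => /eqP <-; exact: in_imfset.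
have [|b bb bd] := @fiber_bij (slot nu) J nat (fun p => val (tag p)) d.
  by move=> m; rewrite slot_fiber nuE.
by exists nu, b.
Qed.

Lemma sum_slots (E : nmodType) (nu : Part) n (G : slot nu -> E) :
  \sum_(p | val (tag p) == n) G p = \sum_(j < nu n) G (slot_of j).
Proof.
rewrite -(big_imset _ (in2W (@slot_of_inj nu n))) /=; apply: eq_bigl => p.
apply/eqP/imsetP => [pn|[j _ ->] //].
by subst n; exists (tagged p); rewrite ?slot_ofK.
Qed.

Section Coefficients.
Variables (gT : finGroupType) (V : rep gT).

(** Averaging the linear map [v |-> c v *: e] over the group. *)
Definition rank_one_fun (c : 'Hom(V, rat^o)) (e v : V) : V :=
  #|gT|%:R^-1 *: \sum_(s : gT) c (rep_act V s^-1%g v) *: rep_act V s e.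

(** Linear forms on [V] correspond, up to the factor #|gT|, to equivariant maps to the
    regular representation. *)
Definition matcoef_fun (J : finType) (c : J -> 'Hom(V, rat^o)) (v : V) : freespace gT J :=
  [ffun q => #|gT|%:R^-1 * c q.1 (rep_act V q.2^-1%g v)].

Fact matcoef_linear (J : finType) (c : J -> 'Hom(V, rat^o)) : linear (matcoef_fun c).
Proof.
move=> a x y; apply/ffunP => q; rewrite !ffunE !linearP mulrDr /GRing.scale /=.
by rewrite mulrCA.
Qed.
HB.instance Definition _ (J : finType) (c : J -> 'Hom(V, rat^o)) :=
  GRing.isLinear.Build rat V (freespace gT J) _ _ (matcoef_linear c).

Definition matcoef (J : finType) (c : J -> 'Hom(V, rat^o)) : 'Hom(V, freerep gT J) :=
  linfun (matcoef_fun c).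

Lemma matcoef_equivariant (J : finType) (c : J -> 'Hom(V, rat^o)) : equivariant (matcoef c).
Proof.
move=> g; apply/lfunP => v; rewrite !comp_lfunE !lfunE /=; apply/ffunP => q.
by rewrite !ffunE /= invMg invgK rep_actM comp_lfunE.
Qed.

Lemma matcoefK (J : finType) (c : J -> 'Hom(V, rat^o)) (e : J -> V) v :
  free_lift e (matcoef c v) = \sum_j rank_one_fun (c j) (e j) v.
Proof.
rewrite !lfunE /= /free_lift_fun /rank_one_fun.
under [RHS]eq_bigr do rewrite scaler_sumr.
rewrite pair_big /=; apply: eq_bigr => -[j s] _ /=.
by rewrite ffunE /= scalerA.
Qed.

Lemma rank_one_scale c a e v : rank_one_fun c (a *: e) v = a *: rank_one_fun c e v.
Proof.
rewrite /rank_one_fun scalerA mulrC -scalerA; congr (_ *: _).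
rewrite scaler_sumr; apply: eq_bigr => s _.
by rewrite linearZ /= !scalerA mulrC.
Qed.

Lemma rank_one0 c v : rank_one_fun c 0 v = 0.
Proof. by have := rank_one_scale c 0 0 v; rewrite !scale0r. Qed.

(** The average of the identity of [V], written in a basis, is the identity. *)
Lemma rank_one_sum v : \sum_(k < \dim {: V})
  rank_one_fun (linfun (coord (vbasis {: V}) k : V -> rat^o)) (vbasis {: V})`_k v = v.
Proof.
rewrite /rank_one_fun -scaler_sumr exchange_big /=.
transitivity (#|gT|%:R^-1 *: \sum_(s : gT) v).
  congr (_ *: _); apply: eq_bigr => s _.
  rewrite -[RHS](id_lfunE v) -(rep_act1 V) -(mulgV s) rep_actM comp_lfunE.
  rewrite [in RHS](coord_vbasis (memvf (rep_act V s^-1%g v))) linear_sum.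
  by apply: eq_bigr => k _; rewrite lfunE linearZ.
rewrite sumr_const -scaler_nat scalerA mulVf ?scale1r // pnatr_eq0 -lt0n.
by apply/card_gt0P; exists 1%g.
Qed.

End Coefficients.

Section Generation.
Variables (W : qob SVect) (M : nat).

Definition unit_index : finType := {n : 'I_M & 'I_(\dim {: W n : vectType rat})}.
Implicit Types i : unit_index.

Definition unit_deg i : nat := tag i.

(** Extending the basis vectors and the coordinates by zero to the other degrees
    avoids transports along equalities of degrees. *)
Definition unit_vec i : forall n, W n :=
  dfwith (fun n => 0 : W n) ((vbasis {: W (unit_deg i) : vectType rat})`_(tagged i)).

Definition unit_coord i : forall n, 'Hom(W n, rat^o) :=
  dfwith (fun n => 0 : 'Hom(W n, rat^o))
    (linfun (coord (vbasis {: W (unit_deg i) : vectType rat}) (tagged i)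
       : W (unit_deg i) -> rat^o)).

(** The endomorphisms [unit_map i] sum to the identity in degrees less than [M]
    and each of them factors through a free module of rank one. *)
Definition unit_map_fun i n : 'Hom(W n, W n) :=
  (free_lift (fun _ : 'I_1 => unit_vec i n) \o matcoef (fun _ : 'I_1 => unit_coord i n))%VF.

Fact unit_map_equivariant i n : equivariant (unit_map_fun i n).
Proof.
move=> g; rewrite /unit_map_fun -comp_lfunA matcoef_equivariant comp_lfunA.
by rewrite (free_lift_equivariant (fun _ : 'I_1 => unit_vec i n)) comp_lfunA.
Qed.

Definition unit_map i : ghom W W :=
  @GHom _ _ W W (unit_map_fun i) (unit_map_equivariant i).

Lemma unit_mapE i n v :
  unit_map i n v = rank_one_fun (unit_coord i n) (unit_vec i n) v.
Proof. by rewrite comp_lfunE matcoefK big_ord1. Qed.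

Lemma unit_map0 i n v : n != unit_deg i -> unit_map i n v = 0.
Proof.
by move=> ni; rewrite unit_mapE /unit_vec dfwith_out 1?eq_sym // rank_one0.
Qed.

Lemma unit_map_sum :
  \sum_i 1 *: unit_map i = scal W (fun n => (n < M)%N%:R) :> ghom W W.
Proof.
apply: ghom_eq => n; apply/lfunP => v; rewrite ghom_sumE scalE.
under eq_bigr do rewrite scale1r.
have [nM|Mn] := ltnP n M; last first.
  rewrite scale0r big1 // => i _; apply: unit_map0; apply: contraTneq Mn => ->.
  by rewrite -ltnNge ltn_ord.
transitivity (\sum_(m : 'I_M) \sum_(k < \dim {: W m : vectType rat})
    unit_map (Tagged (fun m : 'I_M => 'I_(\dim {: W m : vectType rat})) k) n v).
  rewrite (sig_big_dep _ _ (fun (m : 'I_M) (k : 'I_(\dim {: W m : vectType rat})) =>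
    unit_map (Tagged (fun m : 'I_M => 'I_(\dim {: W m : vectType rat})) k) n v)) /=.
  by apply: eq_bigr => -[].
rewrite (bigD1 (Ordinal nM)) //= [X in _ + X]big1 ?addr0 => [|m mn]; last first.
  rewrite big1 // => k _; apply: unit_map0; apply: contra mn => /eqP nm.
  by apply/eqP/val_inj; rewrite /= nm.
rewrite scale1r -[RHS]rank_one_sum; apply: eq_bigr => k _.
by rewrite unit_mapE /unit_vec /unit_coord !dfwith_in.
Qed.

Variables (J : finType) (tau : J -> unit_index) (nu : Part) (b : slot nu -> J).
Hypotheses (bb : bijective b) (bdeg : forall p, unit_deg (tau (b p)) = val (tag p)).

(** [split_out o diag a o split_in] combines the maps [unit_map (tau j)], so that [F]
    at such a combination factors through [F (free nu)]. *)
Definition split_in : ghom W (free nu) :=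
  @GHom _ _ W (free nu) (fun n => matcoef (fun j : 'I_(nu n) => unit_coord (tau (b (slot_of j))) n))
    (fun n => matcoef_equivariant (fun j : 'I_(nu n) => unit_coord (tau (b (slot_of j))) n)).

Definition split_out : ghom (free nu) W :=
  slift (fun p => unit_vec (tau (b p)) (val (tag p)) : slot_family W p).

Lemma split_diag (a : J -> rat) :
  ghom_comp split_out (ghom_comp (diag (fun p => a (b p))) split_in) =
  \sum_i (\sum_(j | tau j == i) a j) *: unit_map i :> ghom W W.
Proof.
have -> : ghom_comp split_out (ghom_comp (diag (fun p => a (b p))) split_in) =
    ghom_comp (slift (fun p => a (b p) *: unit_vec (tau (b p)) (val (tag p)) : slot_family W p)) split_in.
  by apply: ghom_eq => n; rewrite /= comp_lfunA; congr (_ \o _)%VF;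
     have /(congr1 (fun f : ghom (free nu) W => f n)) := slift_diag (fun p => a (b p))
       (fun p => unit_vec (tau (b p)) (val (tag p)) : slot_family W p).
apply: ghom_eq => n; apply/lfunP => v; rewrite comp_lfunE ghom_sumE.
rewrite [LHS]matcoefK.
transitivity (\sum_(j < nu n) a (b (slot_of j)) *: unit_map (tau (b (slot_of j))) n v).
  by apply: eq_bigr => j _; rewrite unit_mapE -rank_one_scale.
rewrite -(sum_slots n (fun p : slot nu => a (b p) *: unit_map (tau (b p)) n v)).
transitivity (\sum_p a (b p) *: unit_map (tau (b p)) n v).
  rewrite [RHS](bigID (fun p : slot nu => val (tag p) == n)) /= [X in _ = _ + X]big1 ?addr0 //.
  by move=> p pn; rewrite unit_map0 ?scaler0 // bdeg eq_sym.
transitivity (\sum_j a j *: unit_map (tau j) n v).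
  by rewrite [RHS](reindex b) //; apply: onW_bij.
rewrite (partition_big tau xpredT) //=; apply: eq_bigr => i _.
by rewrite scaler_suml; apply: eq_bigr => j /eqP ->.
Qed.

End Generation.

Lemma bijb_comp (L J J' : finType) (b : J -> J') (col : L -> J) : bijective b ->
  bijb (fun l => b (col l)) = bijb col.
Proof.
move=> bb; rewrite /bijb (bij_eq_card bb); congr (_ && _).
apply/injectiveP/injectiveP => ci l l' => [/(congr1 b)/ci //|/(bij_inj bb)/ci //].
Qed.

(** The maps [unit_map i] sum to a projection that [F] sends to the identity, and
    polarization expands [F] at this sum into multilinear terms, which factor
    through free modules.  The conclusion keeps the form [mlproj (F h z)] of the
    generating vectors because the injectivity of [theta] depends on it. *)
Lemma generation (F : functor SVect Vect) (W : qob SVect) (z : fob F W)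
    (Q : fob F W -> Prop) :
  @polynomial_functor SVect Vect F ->
  Q 0 -> (forall a x y, Q x -> Q y -> Q (a *: x + y)) ->
  (forall (nu : Part) (h : ghom W (free nu)) (g : ghom (free nu) W)
     (K : finType) (w : K -> rat) (pt : K -> slot nu -> rat),
     (forall y, isML (mlproj (F := F) w pt y)) ->
     Q (fm F g (mlproj w pt (fm F h z)))) ->
  Q z.
Proof.
move=> Fpoly Q0 Qlin QP; have [M MP] := fm_support Fpoly W.
pose f (a : unit_index W M -> rat) := fm F (\sum_i a i *: unit_map i : ghom W W) z.
have -> : z = f (fun=> 1) by rewrite /f unit_map_sum MP id_lfunE.
apply: (polarization (f := f)) => //.
  by apply: polyexp_eval; apply: fm_polyexp.
move=> n tau.
have [nu [b [bb bdeg]]] := sort_slots (fun j => unit_deg (tau j)).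
have [N0 N0P] := mlproj_ML nu Fpoly; exists N0 => N N0N K w pt wP.
pose pt' k (p : slot nu) := pt k (b p).
have wP' : mlweights N w pt'.
  by move=> L col LN; rewrite -(bijb_comp col bb) -(wP L (fun l => b (col l)) LN).
have [projML _] := N0P N N0N K w pt' wP'.
have := QP nu (split_in tau b) (split_out tau b) K w pt' projML.
congr (Q _); rewrite /mlproj linear_sum; apply: eq_bigr => k _.
rewrite linearZ /= -[fm F (diag _) _]fm_compE -fm_compE /pt' split_diag //.
Qed.

(** * The equivalence *)

Lemma natural_inverse (C D : category) (F G : functor C D) (s : natural F G) :
  (forall X, exists t : hom (G X) (F X), comp t (s X) = idm (F X) /\ comp (s X) t = idm (G X)) ->
  exists t : natural G F, forall X, comp (t X) (s X) = idm (F X) /\ comp (s X) (t X) = idm (G X).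
Proof.
move=> sinv; pose t X := projT1 (cid (sinv X)).
have ts X : comp (t X) (s X) = idm (F X) by have [] := projT2 (cid (sinv X)).
have st X : comp (s X) (t X) = idm (G X) by have [] := projT2 (cid (sinv X)).
have tN X Y (f : hom X Y) : comp (t Y) (fmap G f) = comp (fmap F f) (t X).
  by rewrite -[fmap G f]compm1 -(st X) (compA (fmap G f)) -naturality !compA ts comp1m.
by exists (Natural tN).
Qed.

Section ThetaIso.
Variable F : polyfun.
Local Notation PV := (P_functor (ML_ob F)).

Lemma theta_fm W W' (h : ghom W W') (z : fob PV W) :
  theta F W' (fm PV h z) = fm (pf F) h (theta F W z).
Proof. exact: theta_natural. Qed.

Lemma theta_mlproj (nu : Part) (K : finType) (w : K -> rat) (pt : K -> slot nu -> rat)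
    (y : fob PV (free nu)) :
  theta F (free nu) (mlproj w pt y) = mlproj w pt (theta F (free nu) y).
Proof.
rewrite /mlproj; elim/big_ind2: _ => [|x1 x2 y1 y2 <- <-|k _]; first exact: linear0.
  exact: linearD.
transitivity (w k *: theta F (free nu) (fm PV (diag (pt k)) y)); first exact: linearZ.
exact: (congr1 (fun v => w k *: v) (theta_fm (diag (pt k)) y)).
Qed.

Lemma theta_eta (nu : Part) (x : ML_rep (pf F) nu) :
  theta F (free nu) (@eta_fun (ML_ob F) nu x) = vsval x.
Proof. by rewrite /eta_fun theta_ptens slift_sgen fm_id id_lfunE. Qed.

(** If [theta z = 0] then the multilinear vectors [mlproj (P h z)] which generate [z]
    are killed by [theta] as well; but [theta] is injective on the image of [eta]. *)
Lemma theta_eq0 W (z : fob PV W) : theta F W z = 0 -> z = 0.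
Proof.
move=> z0; apply: (generation (F := PV) (Q := fun x => x = 0)) => //.
- exact: P_polynomial.
- by move=> a x y -> ->; rewrite scaler0 addr0.
move=> nu h g K w pt wML; have [v vE] := eta_surj (wML (fm PV h z)).
have v0 : v = 0.
  apply/val_inj; rewrite -[LHS]theta_eta -vE theta_mlproj theta_fm z0 linear0.
  by rewrite /mlproj big1 // => k _; rewrite linear0 scaler0.
by rewrite vE v0 linear0 linear0.
Qed.

Lemma theta_surj W (z : fob (pf F) W) : exists y, theta F W y = z.
Proof.
suff : z \in limg (theta F W) by move/memv_imgP=> [y _ ->]; exists y.
apply: (generation (F := pf F) (Q := fun x => x \in limg (theta F W))).
- exact: pf_poly.
- exact: mem0v.
- by move=> a x y xi yi; rewrite memvD ?memvZ.
move=> nu h g K w pt wML; set y := mlproj _ _ _.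
have yML : y \in MLs (pf F) nu by apply/memMLs; apply: wML.
have <- : vsval (vsproj (MLs (pf F) nu) y : ML_rep (pf F) nu) = y by apply: vsprojK.
by rewrite -theta_eta -theta_fm; apply: memv_img; apply: memvf.
Qed.

Fact theta_nat_subproof W W' (h : qhom (q := SVect) W W') :
  (theta F W' \o fm PV h)%VF = (fm (pf F) h \o theta F W)%VF.
Proof.
apply/lfunP => z.
exact: etrans (comp_lfunE _ _ _) (etrans (theta_fm h z) (esym (comp_lfunE _ _ _))).
Qed.

Definition theta_nat : natural PV (pf F) :=
  @Natural SVect Vect PV (pf F) (theta F) theta_nat_subproof.

Lemma theta_nat_inverse : exists t : natural (pf F) PV,
  forall W, comp (t W) (theta_nat W) = idm (PV W) /\ comp (theta_nat W) (t W) = idm (pf F W).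
Proof.
apply: natural_inverse => W; exists (theta F W)^-1%VF; split.
  apply: lker0_compVf; apply/lker0P => z z' zz'; apply/eqP; rewrite -subr_eq0; apply/eqP.
  by apply: theta_eq0; rewrite linearB /= zz' subrr.
apply/lfunP => z; rewrite id_lfunE; have [y <-] := theta_surj z.
by rewrite comp_lfunE limg_lfunVK // memv_img ?memvf.
Qed.

End ThetaIso.

Section EtaIso.
Variable V : S2Vect_bounded.

Definition eta_hom_fun (nu : Part) : 'Hom(part V nu, ML_rep (P_functor V) nu) :=
  (linfun (vsproj (MLs (P_functor V) nu)) \o linfun (@eta_fun V nu))%VF.

Lemma eta_hom_funE (nu : Part) v : vsval (@eta_hom_fun nu v) = eta_fun v.
Proof.
have vM : eta_fun v \in MLs (P_functor V) nu by apply/memMLs; apply: eta_ML.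
by rewrite comp_lfunE !lfunE; apply: vsprojK.
Qed.

Fact eta_hom_equivariant (nu : Part) : equivariant (eta_hom_fun nu).
Proof.
move=> g; apply/lfunP => v; apply/val_inj.
rewrite (comp_lfunE (eta_hom_fun nu)) (comp_lfunE (rep_act (ML_rep (P_functor V) nu) g)).
rewrite [LHS]eta_hom_funE eta_act [RHS](ML_actE g (eta_hom_fun nu v)).
by congr (_ _); apply/esym/eta_hom_funE.
Qed.

Definition eta_hom : ghom (fs_ob V : gmod Sgrp) (ML_gmod (P_functor V)) :=
  @GHom _ _ (fs_ob V : gmod Sgrp) (ML_gmod (P_functor V)) eta_hom_fun eta_hom_equivariant.

Lemma eta_hom_inverse : exists t : ghom (ML_gmod (P_functor V)) (fs_ob V : gmod Sgrp),
  ghom_comp t eta_hom = ghom_id _ /\ ghom_comp eta_hom t = ghom_id _.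
Proof.
have ker0 nu : lker (eta_hom_fun nu) == 0%VS.
  by apply/lker0P => v v' vv'; apply: eta_inj; rewrite -!eta_hom_funE vv'.
have invK nu : (eta_hom_fun nu \o (eta_hom_fun nu)^-1 = \1)%VF.
  apply/lfunP => x; rewrite id_lfunE comp_lfunE limg_lfunVK //.
  have [v xv] := eta_surj (vsval_ML x).
  have -> : x = eta_hom_fun nu v by apply/val_inj; apply: etrans xv (esym (eta_hom_funE v)).
  by apply: memv_img; apply: memvf.
have invE nu : @equivariant _ (ML_rep (P_functor V) nu) (part V nu) (eta_hom_fun nu)^-1%VF.
  move=> g; apply/lfunP => x.
  rewrite (comp_lfunE (eta_hom_fun nu)^-1%VF) (comp_lfunE (rep_act (part V nu) g)).
  have ekx y : eta_hom_fun nu ((eta_hom_fun nu)^-1%VF y) = y.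
    by have /lfunP/(_ y) := invK nu; rewrite comp_lfunE id_lfunE.
  have /lker0P inj := ker0 nu; apply: inj; rewrite ekx.
  have /lfunP/(_ ((eta_hom_fun nu)^-1%VF x)) := @eta_hom_equivariant nu g.
  rewrite (comp_lfunE (eta_hom_fun nu)) (comp_lfunE (rep_act (ML_rep _ nu) g)) => ->.
  by rewrite ekx.
exists (@GHom _ _ (ML_gmod (P_functor V)) (fs_ob V : gmod Sgrp) _ invE); split.
  by apply: ghom_eq => nu; apply: lker0_compVf.
by apply: ghom_eq => nu; apply: invK.
Qed.

End EtaIso.

Lemma P_assignment_bounded (V : S2Vect_bounded) : bounded_polynomial (P_assignment V).
Proof. by split; [apply: P_polynomial | apply: P_bounded]. Qed.

Local Notation PC := (corestrict P_assignment_bounded).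

Lemma eta_hom_natural (V V' : S2Vect_bounded) (f : hom V V') :
  ghom_comp (eta_hom V') f = ghom_comp (ML_map (P_natural f)) (eta_hom V).
Proof.
apply: ghom_eq => nu; apply/lfunP => v; apply/val_inj.
rewrite (comp_lfunE (eta_hom_fun V' nu)) (comp_lfunE (ML_map_fun (P_natural f) nu)).
rewrite [LHS]eta_hom_funE [RHS]ML_map_funE.
apply/esym; apply: etrans (congr1 (nc _ _) (eta_hom_funE v)) _.
rewrite /nc /eta_fun; apply: etrans (P_mapE_pure f (qid (free nu)) v _) _.
congr (ptens _ _ _ _ (pure _)).
by apply: functional_extensionality_dep => p; rewrite id_lfunE.
Qed.

Lemma eta_iso : naturally_isomorphic (comp_functor ML_functor PC) (id_functor S2Vect_bounded).
Proof.
pose s : natural (id_functor S2Vect_bounded) (comp_functor ML_functor PC) :=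
  @Natural _ _ (id_functor S2Vect_bounded) (comp_functor ML_functor PC) eta_hom eta_hom_natural.
have [|t tP] := @natural_inverse _ _ _ _ s; first by move=> V; apply: eta_hom_inverse.
by exists t, s => V; have [] := tP V.
Qed.

Lemma theta_iso : naturally_isomorphic (comp_functor PC ML_functor)
  (id_functor (polynomial_functors SVect)).
Proof.
have sN (F G : polynomial_functors SVect) (f : hom F G) :
    nat_comp (theta_nat G) (P_natural (ML_map (f : natural (pf F) (pf G)) : hom (ML_ob F) (ML_ob G))) =
    nat_comp f (theta_nat F).
  apply: natural_eq => W; apply/lfunP => z.
  apply: etrans (comp_lfunE _ _ _) (etrans _ (esym (comp_lfunE _ _ _))).
  exact: theta_ML_map.
pose s : natural (comp_functor PC ML_functor) (id_functor (polynomial_functors SVect)) :=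
  @Natural _ _ (comp_functor PC ML_functor) (id_functor (polynomial_functors SVect)) theta_nat sN.
have [|t tP] := @natural_inverse _ _ _ _ s; last by exists s, t.
move=> F; have [t tP] := theta_nat_inverse F; exists t.
by split; apply: natural_eq => W; have [] := tP W.
Qed.

Theorem theorem3p6 :
  (forall V : S2Vect_bounded, @polynomial_functor SVect Vect (P_functor V)) /\
  exists Ppoly : (forall V : S2Vect_bounded, bounded_polynomial (P_assignment V)),
    @is_equivalence S2Vect_bounded (polynomial_functors SVect)
      (corestrict Ppoly).
Proof.
split; first exact: P_polynomial.
exists P_assignment_bounded, ML_functor; split; [exact: eta_iso | exact: theta_iso].
Qed.
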